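(* Suppose $r'(q_0)=0$ and $r''(q_0)<0$. Then there exists $\varepsilon_0>0$ such that for every ambiguity set $\mathcal{S}$ (as defined in the context) with $\varepsilon\le\varepsilon_0$, the projected subgradient algorithm (Algorithm 1, described in the context) with constant step size $$\eta_k=\frac{K_4}{K_3^2+K_2K_4}$$ satisfies $$J(\mathbf{x}_T,a_T)-J(\mathbf{x}^*,a^* )\le\frac{K_3^2+K_2K_4}{2K_4}\exp\!\left(-\frac{K_4\,\lambda_M(1-q_0-\varepsilon_0)}{K_3^2+K_2K_4}\,T\right)\|(\mathbf{x}_0,a_0)-(\mathbf{x}^*,a^* )\|^2,$$ where $K_4:=-q_0\,r(q_0)\,r''(q_0)/d>0$ and $(\mathbf{x}^*,a^* )$ is the minimizer of $J$ over $\Delta\times I$.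
   Context: $\Delta=\{\mathbf{x}\in\mathbb{R}^d:\mathbf{x}\ge 0,\ \mathbf{1}'\mathbf{x}=1\}$; $\|\cdot\|$ is the Euclidean norm, $\|\cdot\|_2$ the operator 2-norm of a matrix; $\mathbf{R}$ is an $\mathbb{R}^d$-valued random vector; $\mathbb{E}_P$ is expectation when $\mathbf{R}\sim P$; $\mu_P,\Sigma_P$ are the mean and covariance matrix of $P$. $W_2(\mu,\nu)^2=\inf\mathbb{E}\|\mathbf{X}-\mathbf{Y}\|^2$ over couplings, and $\mathbb{B}_{W_2}(\mu,r)=\{\nu:W_2(\mu,\nu)\le r\}$. Standing data: $\gamma>0$; $P_N,P_{S_0}$ are Borel probability measures on $\mathbb{R}^d$ with finite second moments and positive definite covariance matrices; $r:[0,1]\to[0,\infty)$ is in $C^2([0,1])$; $q_0\in(0,1)$, $0<\varepsilon<\min(q_0,1-q_0)$ (and likewise $\varepsilon_0<\min(q_0,1-q_0)$); $$\mathcal{S}=\{(1-q)P_N+qP_S:\ q\in[q_0-\varepsilon,q_0+\varepsilon],\ P_S\in\mathbb{B}_{W_2}(P_{S_0},r(q))\}.$$ $I\subset\mathbb{R}$ is a fixed compact interval, not depending on $\mathbf{x}$, containing $\mathbb{E}_P(\mathbf{x}'\mathbf{R})$ for all $\mathbf{x}\in\Delta$, $P\in\mathcal{S}$. Define $$\psi_{a,\gamma}(y)=(y-a)^2-\gamma y,\qquad S_\gamma(\mathbf{x},a)=\sqrt{\mathbf{x}'\Sigma_{P_{S_0}}\mathbf{x}+\left(\mathbf{x}'\mu_{P_{S_0}}-\tfrac{2a+\gamma}{2}\right)^2},$$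 $$h(q,\mathbf{x},a)=(1-q)\mathbb{E}_{P_N}(\psi_{a,\gamma}(\mathbf{x}'\mathbf{R}))+q\left[(r(q)\|\mathbf{x}\|+S_\gamma(\mathbf{x},a))^2-a\gamma-\tfrac{\gamma^2}{4}\right],$$ $$J(\mathbf{x},a)=\sup_{q\in[q_0-\varepsilon,q_0+\varepsilon]}h(q,\mathbf{x},a),\qquad \Omega=\{(q,\mathbf{x},a): q\in[q_0-\varepsilon,q_0+\varepsilon],\ \mathbf{x}\in\Delta,\ a\in I\}.$$ $$K_2=\max_{\Omega}\left\|\frac{\partial^2h}{\partial(\mathbf{x},a)^2}\right\|_2,\qquad K_3=\max_{\Omega}\left\|\frac{\partial^2h}{\partial q\,\partial(\mathbf{x},a)}\right\|$$ (positive constants). $\lambda_M$ is the smallest eigenvalue of $$M=\begin{pmatrix}\Sigma_{P_N}+\mu_{P_N}\mu_{P_N}'&-\mu_{P_N}\\-\mu_{P_N}'&1\end{pmatrix}.$$ ($J$ is strongly convex, so its minimizer over $\Delta\times I$ is unique.) Algorithm 1: choose $(\mathbf{x}_0,a_0)\in\Delta\times I$, a number of iterations $T>0$ and step sizes $\eta_k>0$. For $k=0,1,\dots,T$: pick $q_k^*\in\arg\max_{|q-q_0|\le\varepsilon}h(q,\mathbf{x}_k,a_k)$; let $(\mathbf{g}_{k,\mathbf{x}},g_{k,a})=\nabla_{(\mathbf{x},a)}h(q_k^*,\mathbf{x}_k,a_k)$; set $\mathbf{x}_{k+1}=\mathrm{Proj}_\Delta(\mathbf{x}_k-\eta_k\mathbf{g}_{k,\mathbf{x}})$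 and $a_{k+1}=a_k-\eta_kg_{k,a}$, where $\mathrm{Proj}_\Delta$ is Euclidean projection onto $\Delta$. Standing convention: the iterates stay in the domain, i.e. $a_k\in I$ for $k=0,\dots,T$, so $(q_k^*,\mathbf{x}_k,a_k)\in\Omega$. *)

(* Defs.v *)
(* Vectors are row vectors; (x, a) in R^d x R is encoded as
   the row vector [pairv x a] of R^(d+1). *)
From HB Require Import structures.
From mathcomp Require Import all_boot all_order all_algebra.
From mathcomp Require Import all_classical all_reals all_analysis.

Set Implicit Arguments.
Unset Strict Implicit.
Unset Printing Implicit Defensive.

Import Order.TTheory GRing.Theory Num.Theory.
Import numFieldNormedType.Exports.

Local Open Scope ring_scope.
Local Open Scope classical_set_scope.

Section Euclidean.
Context {R : realType}.

Definition dot n (x y : 'rV[R]_n) : R := (x *m y^T) 0 0.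

(* The library norm on matrices is the sup norm, hence a separate definition. *)
Definition enorm n (x : 'rV[R]_n) : R := Num.sqrt (dot x x).

(* v *m A^T is the row form of A v'. *)
Definition opnorm2 m n (A : 'M[R]_(m, n)) : R :=
  sup [set enorm (v *m A^T) | v in [set v : 'rV[R]_n | enorm v <= 1]].

Definition posdefmx n (A : 'M[R]_n) : Prop :=
  A^T = A /\ forall v : 'rV[R]_n, v != 0 -> 0 < dot (v *m A) v.

Definition min_eigenvalue n (A : 'M[R]_n) : R :=
  inf [set l : R | eigenvalue A l].

Definition grad n (f : 'rV[R]_n -> R) (z : 'rV[R]_n) : 'rV[R]_n :=
  \row_i 'D_(delta_mx 0 i) f z.

Definition hessian n (f : 'rV[R]_n -> R) (z : 'rV[R]_n) : 'M[R]_n :=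
  \matrix_(i, j) 'D_(delta_mx 0 i) ('D_(delta_mx 0 j) f) z.

Definition simplex d : set 'rV[R]_d :=
  [set x | (forall i, 0 <= x 0 i) /\ \sum_i x 0 i = 1].

Definition is_eproj d (A : set 'rV[R]_d) (y p : 'rV[R]_d) : Prop :=
  A p /\ forall z, A z -> enorm (y - p) <= enorm (y - z).

Definition pairv d (x : 'rV[R]_d) (a : R) : 'rV[R]_(d + 1) := row_mx x a%:M.

(* Derivative relative to A: one-sided at an endpoint of an interval A. *)
Definition is_deriv_on (A : set R) (f f' : R -> R) : Prop :=
  forall x, A x ->
    (fun y => (f y - f x) / (y - x)) @ within A x^' --> f' x.

Definition C2_on (A : set R) (f : R -> R) : Prop :=
  exists f1 f2 : R -> R,
    [/\ is_deriv_on A f f1, is_deriv_on A f1 f2 & {within A, continuous f2}].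

End Euclidean.

(* R^d with its Borel sigma-algebra. *)
Definition borel (R : realType) (d : nat) :=
  g_sigma_algebraType (@open 'rV[R]_d).

Section Laws.
Context {R : realType} {d : nat}.
Implicit Types P mu nu : probability (borel R d) R.

Definition finite_second_moment P : Prop :=
  ('E_P[fun z : 'rV[R]_d => (enorm z ^+ 2)%R] < +oo)%E.

Definition meanv P : 'rV[R]_d := \row_i fine 'E_P[fun z : 'rV[R]_d => z 0%R i]%E.

Definition covmx P : 'M[R]_d :=
  \matrix_(i, j) fine (covariance P (fun z : 'rV[R]_d => z 0 i)
                                    (fun z : 'rV[R]_d => z 0 j)).

Definition is_coupling mu nu
    (pi : probability (borel R d * borel R d)%type R) : Prop :=
  forall A : set (borel R d), measurable A ->
    pi (A `*` setT) = mu A /\ pi (setT `*` A) = nu A.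

Definition W2 mu nu : \bar R :=
  sqrte (ereal_inf
    [set 'E_pi[fun z : 'rV[R]_d * 'rV[R]_d => (enorm (z.1 - z.2)%R ^+ 2)%R]%E
      | pi in is_coupling mu nu]).

Definition W2_ball mu (rho : R) : set (probability (borel R d) R) :=
  [set nu | (W2 mu nu <= rho%:E)%E].

End Laws.

Section Model.
Context {R : realType} {d : nat}.
Variables (PN PS0 : probability (borel R d) R) (r : R -> R).
Variables (gamma q0 eps : R).
Implicit Types (q a : R) (x : 'rV[R]_d).

Definition ambiguity_set : set (probability (borel R d) R) :=
  [set P | exists q PS,
    [/\ q0 - eps <= q <= q0 + eps, W2_ball PS0 (r q) PS &
     forall A, measurable A ->
       P A = ((1 - q)%:E * PN A + q%:E * PS A)%E] ].

Definition psi a (y : R) : R := (y - a) ^+ 2 - gamma * y.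

Definition Sgamma x a : R :=
  Num.sqrt (dot (x *m covmx PS0) x +
            (dot x (meanv PS0) - (2 * a + gamma) / 2) ^+ 2).

Definition hobj q x a : R :=
  (1 - q) * fine 'E_PN[fun z : 'rV[R]_d => psi a (dot x z)]%E +
  q * ((r q * enorm x + Sgamma x a) ^+ 2 - a * gamma - gamma ^+ 2 / 4).

Definition hpair q (z : 'rV[R]_(d + 1)) : R :=
  hobj q (lsubmx z) (rsubmx z 0 0).

Definition Jobj x a : R :=
  sup [set hobj q x a | q in `[q0 - eps, q0 + eps]].

(* The suprema below are maxima of continuous functions on a compact set. *)
Definition K2const (I : set R) : R :=
  sup [set v | exists q x a,
    [/\ q0 - eps <= q <= q0 + eps, simplex x, I a &
     v = opnorm2 (hessian (hpair q) (pairv x a))] ].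

Definition mixed_partial q (z : 'rV[R]_(d + 1)) : 'rV[R]_(d + 1) :=
  \row_i (fun p => grad (hpair p) z 0 i)^`() q.

Definition K3const (I : set R) : R :=
  sup [set v | exists q x a,
    [/\ q0 - eps <= q <= q0 + eps, simplex x, I a &
     v = enorm (mixed_partial q (pairv x a))] ].

Definition Mmx : 'M[R]_(d + 1) :=
  block_mx (covmx PN + (meanv PN)^T *m meanv PN) (- (meanv PN)^T)
           (- meanv PN)                          1%:M.

Definition lambdaM : R := min_eigenvalue Mmx.

Definition is_argmax_h x a q : Prop :=
  q0 - eps <= q <= q0 + eps /\
  forall p, q0 - eps <= p <= q0 + eps -> hobj p x a <= hobj q x a.

Definition is_minimizer_J (I : set R) x a : Prop :=
  [/\ simplex x, I a &
   forall y b, simplex y -> I b -> Jobj x a <= Jobj y b].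

(* Projected subgradient iterations k = 0, ..., T; xs, as_ and qs are the
   sequences x_k, a_k and q_k^*, and a_k is required to stay in I. *)
Definition psubgrad_run (I : set R) (eta : nat -> R) (T : nat)
    (xs : nat -> 'rV[R]_d) (as_ qs : nat -> R) : Prop :=
  simplex (xs 0%N) /\
  forall k, (k <= T)%N ->
    let g := grad (hpair (qs k)) (pairv (xs k) (as_ k)) in
    [/\ I (as_ k),
        is_argmax_h (xs k) (as_ k) (qs k),
        is_eproj (@simplex R d) (xs k - eta k *: lsubmx g) (xs k.+1) &
        as_ k.+1 = as_ k - eta k * rsubmx g 0 0].

End Model.

(* Main.v *)
Require Import Defs.
From HB Require Import structures.
From mathcomp Require Import all_boot all_order all_algebra.
From mathcomp Require Import all_classical all_reals all_analysis.
From mathcomp Require Import measurable_realfun ring lra.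
Set Implicit Arguments.
Unset Strict Implicit.
Unset Printing Implicit Defensive.
Import Order.TTheory GRing.Theory Num.Theory.
Import numFieldNormedType.Exports.
Local Open Scope ring_scope.
Local Open Scope classical_set_scope.

(** Write [z = (x, a)], let [h q z] be the objective, and let [J z] be the
    maximum of [h q z] over the parameter interval around [q0].

    In [z], the nominal part of [h q] is a quadratic form with matrix
    [(1 - q) M] plus a linear term, and the worst-case part is [q] times the
    square of [s = r q |x| + S], up to a linear term.  Both [|x|] and [S] are
    norms of affine maps, so [s] is convex and nonnegative, its square is
    convex, and [h q] lies above its tangents by at least
    [(1 - q) lambda_M |z' - z| ^ 2] ([obj_tangent_le], [min_eigenvalue_le]).

    In [q], the second derivative of [h] is
    [2 s |x| (2 r' + q r'') + 2 q r' ^ 2 |x| ^ 2].  At [q0] one has [r' = 0] and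
    [r'' < 0], so near [q0] the factor [2 r' + q r''] is negative and [s] can be
    replaced by its lower bound [r |x|]; as [|x| ^ 2 >= 1 / d] on the simplex,
    the second derivative is then at most [- K4], uniformly in [a]
    ([obj_qq_le], [concavity_interval]).  This uniformity is what allows the
    radius of the parameter interval to be fixed before the range of [a].

    These two facts make [J] behave like an [L]-smooth function with
    [L = K2 + K3 ^ 2 / K4].  Let [q] maximize [h . z].  For any other parameter
    [p], strong concavity gives [h p z <= h q z - K4 / 2 (p - q) ^ 2], the
    gradients at [p] and [q] differ by at most [K3 |p - q|], and Taylor's
    formula in [z] costs [K2 / 2 |z' - z| ^ 2]; completing the square in
    [p - q] yields
    [J z' <= J z + <g, z' - z> + L / 2 |z' - z| ^ 2] ([descent]).
    A projected step of length [1 / L] along [g] then contracts the squared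
    distance to the minimizer, and the gap in [J] follows from the last step
    ([projected_step_gap], [linear_rate]).

    The constants [K2] and [K3] are suprema, and they bound the derivatives
    only because those are bounded on the domain: on the simplex [|x|] is
    bounded away from [0], and so is [S], the covariance being positive
    definite ([domain_pos], [hessian_bounded], [mixed_bounded]). *)

(** * Euclidean geometry of row vectors *)

Section EuclideanFacts.
Context {R : realType}.

Lemma dot_sum n (x y : 'rV[R]_n) : dot x y = \sum_i x 0 i * y 0 i.
Proof. by rewrite /dot mxE; apply: eq_bigr => i _; rewrite mxE. Qed.

Lemma dotC n (x y : 'rV[R]_n) : dot x y = dot y x.
Proof. by rewrite !dot_sum; apply: eq_bigr => i _; rewrite mulrC. Qed.

Lemma dotDl n (x y z : 'rV[R]_n) : dot (x + y) z = dot x z + dot y z.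
Proof. by rewrite /dot mulmxDl mxE. Qed.

Lemma dotZl n c (x z : 'rV[R]_n) : dot (c *: x) z = c * dot x z.
Proof. by rewrite /dot -scalemxAl mxE. Qed.

Lemma dotDr n (x y z : 'rV[R]_n) : dot z (x + y) = dot z x + dot z y.
Proof. by rewrite !(dotC z) dotDl. Qed.

Lemma dotZr n c (x z : 'rV[R]_n) : dot z (c *: x) = c * dot z x.
Proof. by rewrite !(dotC z) dotZl. Qed.

Lemma dotNl n (x z : 'rV[R]_n) : dot (- x) z = - dot x z.
Proof. by rewrite -scaleN1r dotZl mulN1r. Qed.

Lemma dotNr n (x z : 'rV[R]_n) : dot z (- x) = - dot z x.
Proof. by rewrite !(dotC z) dotNl. Qed.

Lemma dot0l n (x : 'rV[R]_n) : dot 0 x = 0.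
Proof. by rewrite -(scale0r 0) dotZl mul0r. Qed.

Definition dot_bilin := (dotDl, dotDr, dotNl, dotNr, dotZl, dotZr).

Lemma dot_ge0 n (x : 'rV[R]_n) : 0 <= dot x x.
Proof. by rewrite dot_sum sumr_ge0 // => i _; rewrite -expr2 sqr_ge0. Qed.

Lemma dot_eq0 n (x : 'rV[R]_n) : (dot x x == 0) = (x == 0).
Proof.
apply/idP/eqP => [|->]; last by rewrite dot0l.
rewrite dot_sum psumr_eq0 => [/allP x0|i _]; last by rewrite -expr2 sqr_ge0.
apply/rowP => i; rewrite mxE; apply/eqP.
by have := x0 i (mem_index_enum _); rewrite mulf_eq0 orbb.
Qed.

Lemma dot_gt0 n (x : 'rV[R]_n) : x != 0 -> 0 < dot x x.
Proof. by move=> x0; rewrite lt0r dot_eq0 x0 dot_ge0. Qed.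

Lemma enorm_ge0 n (x : 'rV[R]_n) : 0 <= enorm x.
Proof. exact: sqrtr_ge0. Qed.

Lemma sqr_enorm n (x : 'rV[R]_n) : enorm x ^+ 2 = dot x x.
Proof. by rewrite sqr_sqrtr // dot_ge0. Qed.

Lemma enorm_gt0 n (x : 'rV[R]_n) : x != 0 -> 0 < enorm x.
Proof. by move=> x0; rewrite sqrtr_gt0 dot_gt0. Qed.

Lemma enormZ n c (x : 'rV[R]_n) : enorm (c *: x) = `|c| * enorm x.
Proof. by rewrite /enorm !dot_bilin mulrA -expr2 sqrtrM ?sqr_ge0// sqrtr_sqr. Qed.

(** A nonnegative quadratic polynomial has nonpositive discriminant.  Every
    Cauchy-Schwarz inequality below is an instance, for [dot] as well as for
    the affine map behind [Sgamma]. *)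
Lemma discriminant_le (a b c : R) :
  0 <= a -> 0 <= c -> (forall t, 0 <= a + 2 * t * b + t ^+ 2 * c) ->
  b <= Num.sqrt a * Num.sqrt c.
Proof.
move=> a0 c0 H.
have Hb : b ^+ 2 <= a * c.
  have [cz|cn0] := eqVneq c 0.
    rewrite cz in H *; have [->|bn0] := eqVneq b 0; first by rewrite mulr0 expr0n.
    have := H (- (a + 1) / (2 * b)); rewrite mulr0 addr0.
    have -> : a + 2 * (- (a + 1) / (2 * b)) * b = -1 by field.
    by rewrite oppr_ge0 ler10.
  have cp : 0 < c by rewrite lt0r cn0.
  have := H (- b / c).
  have -> : a + 2 * (- b / c) * b + (- b / c) ^+ 2 * c = (a * c - b ^+ 2) / c.
    by field.
  by rewrite pmulr_lge0 ?invr_gt0// subr_ge0.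
rewrite -sqrtrM //; apply: le_trans (ler_norm b) _.
by rewrite -sqrtr_sqr ler_wsqrtr.
Qed.

Lemma dot_le_enorm n (x y : 'rV[R]_n) : dot x y <= enorm x * enorm y.
Proof.
apply: discriminant_le; rewrite ?dot_ge0// => t.
have := dot_ge0 (x + t *: y); rewrite !dot_bilin (dotC y x); congr (_ <= _).
by ring.
Qed.

Lemma entry_le_enorm n (x : 'rV[R]_n) i : `|x 0 i| <= enorm x.
Proof.
rewrite -sqrtr_sqr ler_wsqrtr// dot_sum (bigD1 i)//= -expr2 lerDl sumr_ge0// => j _.
by rewrite -expr2 sqr_ge0.
Qed.

Lemma enorm_le_sum n (x : 'rV[R]_n) : enorm x <= \sum_i `|x 0 i|.
Proof.
rewrite -(@ler_pXn2r _ 2) ?nnegrE ?enorm_ge0 ?sumr_ge0// sqr_enorm dot_sum.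
rewrite expr2 mulr_suml; apply: ler_sum => i _.
apply: le_trans (ler_norm _) _; rewrite normrM ler_wpM2l//.
by rewrite (bigD1 i)//= lerDl sumr_ge0.
Qed.

Definition mxsum m n (A : 'M[R]_(m, n)) : R := \sum_i \sum_j `|A i j|.

Lemma enorm_mulmx_le m n (A : 'M[R]_(m, n)) v :
  enorm (v *m A^T) <= mxsum A * enorm v.
Proof.
apply: le_trans (enorm_le_sum _) _; rewrite mulr_suml; apply: ler_sum => i _.
rewrite mxE mulr_suml; apply: le_trans (ler_norm_sum _ _ _) _.
apply: ler_sum => j _; rewrite mxE normrM mulrC ler_wpM2l//.
exact: entry_le_enorm.
Qed.

Lemma opnorm2_ubound m n (A : 'M[R]_(m, n)) :
  ubound [set enorm (v *m A^T) | v in [set v : 'rV[R]_n | enorm v <= 1]]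
         (mxsum A).
Proof.
move=> _ [v /= v1 <-]; apply: le_trans (enorm_mulmx_le _ _) _.
by rewrite ler_piMr// /mxsum sumr_ge0// => i _; rewrite sumr_ge0.
Qed.

Lemma opnorm2_le m n (A : 'M[R]_(m, n)) : opnorm2 A <= mxsum A.
Proof.
apply: ge_sup; last exact: opnorm2_ubound.
by exists (enorm (0 *m A^T)); exists 0 => //=; rewrite /enorm dot0l sqrtr0.
Qed.

Lemma le_opnorm2 m n (A : 'M[R]_(m, n)) v :
  enorm (v *m A^T) <= opnorm2 A * enorm v.
Proof.
have [->|v0] := eqVneq v 0; first by rewrite mul0mx /enorm !dot0l sqrtr0 mulr0.
have nv := enorm_gt0 v0.
have nVv : 0 <= (enorm v)^-1 by rewrite invr_ge0 enorm_ge0.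
rewrite -ler_pdivrMr// mulrC -[(enorm v)^-1]ger0_norm// -enormZ scalemxAl.
apply: ub_le_sup; last first.
  by exists ((enorm v)^-1 *: v) => //=; rewrite enormZ ger0_norm// mulVf ?gt_eqF.
by exists (mxsum A); exact: opnorm2_ubound.
Qed.

Lemma opnorm2_ge0 m n (A : 'M[R]_(m, n)) : 0 <= opnorm2 A.
Proof.
apply: le_trans (enorm_ge0 (0 *m A^T)) _; apply: ub_le_sup; last first.
  by exists 0 => //=; rewrite /enorm dot0l sqrtr0.
by exists (mxsum A); exact: opnorm2_ubound.
Qed.

Lemma dot_mulmx_le_opnorm2 n (A : 'M[R]_n) v :
  dot (v *m A^T) v <= opnorm2 A * dot v v.
Proof.
apply: le_trans (dot_le_enorm _ _) _.
by rewrite -sqr_enorm expr2 mulrA ler_wpM2r ?enorm_ge0// le_opnorm2.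
Qed.

Lemma dot_mulmx n (A : 'M[R]_n) v w :
  dot (v *m A) w = \sum_i \sum_j v 0 i * w 0 j * A i j.
Proof.
rewrite dot_sum exchange_big/=; apply: eq_bigr => j _.
by rewrite mxE mulr_suml; apply: eq_bigr => i _; ring.
Qed.

Lemma dot_mulmx_sym n (A : 'M[R]_n) v w :
  A^T = A -> dot (v *m A) w = dot (w *m A) v.
Proof.
move=> sA; rewrite !dot_mulmx exchange_big/=; apply: eq_bigr => j _.
by apply: eq_bigr => i _; rewrite -{1}sA mxE (mulrC (v 0 i)).
Qed.

(** The points [p + t (z - p)] of the convex set are no closer to [y] than [p];
    expanding the square and letting [t] be small leaves the obtuse angle. *)
Lemma proj_variational n (C : set 'rV[R]_n) y p z :
  (forall u v (t : R), C u -> C v -> 0 <= t <= 1 -> C (u + t *: (v - u))) ->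
  is_eproj C y p -> C z -> dot (y - p) (z - p) <= 0.
Proof.
move=> cC [Cp pmin] Cz; have [w wE] : exists w, w = z - p by exists (z - p).
have [e eE] : exists e, e = y - p by exists (y - p).
rewrite -wE -eE.
have H t : 0 < t <= 1 -> 2 * dot e w <= t * dot w w.
  move=> /andP[t0 t1]; have Cq := cC p z t Cp Cz.
  have {}Cq : C (p + t *: w) by rewrite wE; apply: Cq; rewrite ltW.
  have := pmin _ Cq; rewrite -(@ler_pXn2r _ 2) ?nnegrE ?enorm_ge0// !sqr_enorm.
  have -> : y - (p + t *: w) = e - t *: w by rewrite opprD addrA eE.
  rewrite -eE !dot_bilin (dotC w e) => le1.
  by rewrite -(ler_pM2l t0); lra.
rewrite leNgt; apply/negP => pos.
have w0 := dot_ge0 w.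
(* Small enough for [t * dot w w <= dot e w]; the [+ 1] covers [w = 0]. *)
pose t := Num.min 1 (dot e w / (dot w w + 1)).
have t0 : 0 < t by rewrite lt_min ltr01 divr_gt0//; lra.
have t1 : t <= 1 by rewrite ge_min lexx.
have := H t; rewrite t0 t1 => /(_ isT).
have : t * dot w w <= dot e w.
  have : t <= dot e w / (dot w w + 1) by rewrite ge_min lexx orbT.
  rewrite ler_pdivlMr; last lra.
  by nra.
by lra.
Qed.

End EuclideanFacts.

(** * The Rayleigh quotient *)

Section Rayleigh.
Context {R : realType}.

Lemma continuous_dot_mulmx n (A : 'M[R]_n) :
  continuous (fun v : 'rV[R]_n => dot (v *m A) v).
Proof.
have -> : (fun v : 'rV[R]_n => dot (v *m A) v) =
    (fun v => \sum_i \sum_j v 0 i * v 0 j * A i j).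
  by apply/funext => v; rewrite dot_mulmx.
apply: continuous_big => [|i _]; first exact: add_continuous.
apply: continuous_big => [|j _]; first exact: add_continuous.
move=> v; apply: (@cvgM _ _ (nbhs v)); last by apply: cvg_cst.
by apply: (@cvgM _ _ (nbhs v)); exact: coord_continuous.
Qed.

Lemma compact_sphere n : compact [set v : 'rV[R]_n | dot v v = 1].
Proof.
apply: bounded_closed_compact.
  exists 1; split; first exact: num_real.
  move=> M M1 v /= v1; apply: le_trans (ltW M1).
  have [M0|/mx_norm_neq0[i /= vi]] := eqVneq (mx_norm v) 0.
    by rewrite [`|v|]M0.
  rewrite [`|v|]vi (ord1 i.1) (le_trans (entry_le_enorm _ _))//.
  by rewrite /enorm v1 sqrtr1.
rewrite (_ : [set _ | _] = (fun v : 'rV[R]_n => dot (v *m 1%:M) v) @^-1` [set 1]).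
  apply: preimage_closed => [v _|]; first exact: continuous_dot_mulmx.
  exact: closed_eq.
by apply/seteqP; split=> v /=; rewrite mulmx1.
Qed.

(** Minimizing the quadratic form over the unit sphere yields an eigenvector:
    at a minimizer [v] the form [A - m] is nonnegative and vanishes at [v], so
    the discriminant inequality kills its polar form at [v]. *)
Lemma rayleigh_min n (A : 'M[R]_n) : (0 < n)%N -> A^T = A ->
  exists m (v : 'rV[R]_n), [/\ v != 0, v *m A = m *: v &
    forall w, m * dot w w <= dot (w *m A) w].
Proof.
move=> n0 sA.
have cS : {within [set v : 'rV[R]_n | dot v v = 1],
    continuous (fun v => dot (v *m A) v)}.
  exact/continuous_subspaceT/continuous_dot_mulmx.
have [|v] := EVT_min_rV _ (@compact_sphere n) cS.
  exists (delta_mx 0 (Ordinal n0)) => /=.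
  rewrite dot_sum (bigD1 (Ordinal n0))//= big1 ?addr0 => [|i /negPf ni].
    by rewrite !mxE !eqxx mulr1.
  by rewrite !mxE ni andbF mulr0.
rewrite inE/= => v1 vmin; set m := dot (v *m A) v in vmin *.
have v0 : v != 0 by rewrite -dot_eq0 v1 oner_eq0.
have min w : m * dot w w <= dot (w *m A) w.
  have [->|w0] := eqVneq w 0; first by rewrite mul0mx !dot0l mulr0.
  have nw := enorm_gt0 w0.
  have w1 : dot ((enorm w)^-1 *: w) ((enorm w)^-1 *: w) = 1.
    by rewrite !dot_bilin -sqr_enorm; field; rewrite gt_eqF.
  have := vmin ((enorm w)^-1 *: w); rewrite inE => /(_ w1).
  rewrite -scalemxAl !dot_bilin mulrA -invfM -expr2 sqr_enorm mulrC.
  by rewrite ler_pdivlMr ?dot_gt0.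
exists m, v; split=> //.
apply/eqP; rewrite -subr_eq0 -dot_eq0 eq_le dot_ge0 andbT.
have [w wE] : exists w, w = v *m A - m *: v by eexists.
rewrite -wE.
have -> : 0 = Num.sqrt 0 * Num.sqrt (dot (w *m A) w - m * dot w w) :> R.
  by rewrite sqrtr0 mul0r.
apply: discriminant_le; rewrite ?subr_ge0// => t.
have := min (v + t *: w); rewrite -subr_ge0; congr (_ <= _).
have e1 : dot w w = dot (v *m A) w - m * dot v w by rewrite {1}wE !dot_bilin.
rewrite mulmxDl -scalemxAl !dot_bilin (dot_mulmx_sym w v sA) (dotC w v) e1 v1 /m.
by ring.
Qed.

(** Rayleigh's minimum is itself an eigenvalue and bounds the others from
    below, so the infimum of the real spectrum bounds the Rayleigh quotient. *)
Lemma min_eigenvalue_le n (A : 'M[R]_n) v : (0 < n)%N -> A^T = A ->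
  min_eigenvalue A * dot v v <= dot (v *m A) v.
Proof.
move=> n0 sA; have [m [u [u0 uA mmin]]] := rayleigh_min n0 sA.
apply: le_trans (mmin v); rewrite ler_wpM2r ?dot_ge0//.
apply: ge_inf; last by apply/eigenvalueP; exists u.
exists m => l /eigenvalueP[w wA w0].
have := mmin w; rewrite wA dot_bilin ler_pM2r// dot_gt0//.
Qed.

Lemma min_eigenvalue_ge0 n (A : 'M[R]_n) : (0 < n)%N -> A^T = A ->
  (forall v, 0 <= dot (v *m A) v) -> 0 <= min_eigenvalue A.
Proof.
move=> n0 sA A_ge0; have [m [u [u0 uA mmin]]] := rayleigh_min n0 sA.
apply: lb_le_inf; first by exists m; apply/eigenvalueP; exists u.
move=> l /eigenvalueP[w wA w0].
by have := A_ge0 w; rewrite wA dot_bilin pmulr_lge0// dot_gt0.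
Qed.

Lemma posdefmx_coercive n (A : 'M[R]_n) : (0 < n)%N -> posdefmx A ->
  exists2 c, 0 < c & forall v, c * dot v v <= dot (v *m A) v.
Proof.
move=> n0 [sA pA]; have [m [u [u0 uA mmin]]] := rayleigh_min n0 sA.
exists m => //; have := pA u u0.
by rewrite uA dot_bilin pmulr_lgt0// dot_gt0.
Qed.

End Rayleigh.

(** * Calculus in one variable *)

Section OneVariable.
Context {R : realType}.
Implicit Types (f phi : R -> R) (K : R).

Lemma is_derive_cvgP (V W : normedModType R) (f : V -> W) (x v : V) df :
  is_derive x v f df <->
  h^-1 *: ((f \o shift x) (h *: v) - f x) @[h --> 0^'] --> df.
Proof.
split=> [[dvf <-]|H]; first exact: dvf.
by apply: DeriveDef; [exact: cvgP H|exact: cvg_lim H].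
Qed.

Lemma is_derive_line (V : normedModType R) (f : V -> R) (z v : V) t df :
  is_derive (z + t *: v) v f df -> is_derive t 1 (fun s => f (z + s *: v)) df.
Proof.
move=> /is_derive_cvgP H; apply/is_derive_cvgP; apply: cvg_trans H.
apply: near_eq_cvg; near=> h => /=.
by rewrite [_%:A]mulr1 scalerDl addrCA.
Unshelve. all: by end_near. Qed.

Lemma is_derive_scale f (x v df : R) :
  is_derive x 1 f df -> is_derive x v f (v * df).
Proof.
move=> fx.
have : is_derive x v f ('d f x v).
  apply: DeriveDef; last by rewrite deriveE//; apply/derivable1_diffP.
  by apply: diff_derivable; apply/derivable1_diffP.
suff -> : 'd f x v = v * df :> R by [].
have fdx : differentiable f x by apply/derivable1_diffP.
rewrite -[in LHS](mulr1 v) -[v * 1]/(v *: (1 : R)) linearZ/=.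
by rewrite -deriveE// derive_val.
Qed.

Lemma is_derive_segment f (q p t df : R) :
  is_derive (q + t * (p - q)) 1 f df ->
  is_derive t 1 (fun s => f (q + s * (p - q))) ((p - q) * df).
Proof. by move=> /(@is_derive_scale _ _ (p - q)); exact: is_derive_line. Qed.

Lemma is_derive_within_continuous f (f1 : R -> R) (a b : R) :
  (forall t : R, a <= t <= b -> is_derive t 1 f (f1 t)) ->
  {within `[a, b], continuous f}.
Proof.
move=> fd; apply: derivable_within_continuous => t; rewrite in_itv/= => tab.
exact: @ex_derive _ _ _ _ _ _ _ (fd t tab).
Qed.

Lemma MVT_ge0 f (f1 : R -> R) (t : R) : 0 <= t ->
  (forall s : R, 0 <= s <= t -> is_derive s 1 f (f1 s)) ->
  exists2 c, 0 <= c <= t & f t - f 0 = f1 c * t.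
Proof.
move=> t0 fd.
have fd' (s : R) : s \in `]0, t[%R -> is_derive s 1 f (f1 s).
  by rewrite in_itv/= => /andP[/ltW s0 /ltW st]; apply: fd; rewrite s0.
have [c] := MVT_segment t0 fd' (is_derive_within_continuous fd).
by rewrite in_itv/= subr0; exists c.
Qed.

(** Second-order Taylor upper bound; integrating the bound on the second
    derivative twice amounts to two applications of the mean value theorem. *)
Lemma taylor2_le phi (phi1 phi2 : R -> R) K :
  (forall t : R, 0 <= t <= 1 -> is_derive t 1 phi (phi1 t)) ->
  (forall t : R, 0 <= t <= 1 -> is_derive t 1 phi1 (phi2 t)) ->
  (forall t : R, 0 <= t <= 1 -> phi2 t <= K) ->
  phi 1 <= phi 0 + phi1 0 + K / 2.
Proof.
move=> d1 d2 bK.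
pose g t := phi t - t * phi1 0 - K / 2 * t ^+ 2.
pose g1 t := phi1 t - phi1 0 - K * t.
have dg (t : R) : 0 <= t <= 1 -> is_derive t 1 g (g1 t).
  move=> t01; have := d1 t t01 => ?; rewrite /g; apply: is_derive_eq.
  by rewrite /g1 /GRing.scale/=; field.
have [c /andP[c0 c1] gE] := MVT_ge0 ler01 dg.
have [|e /andP[e0 ec] phi1E] := @MVT_ge0 phi1 phi2 c c0.
  by move=> s /andP[s0 sc]; apply: d2; rewrite s0 (le_trans sc).
have := bK e; rewrite e0 (le_trans ec c1) => /(_ isT) K2.
have : g1 c <= 0 by rewrite /g1 phi1E -mulrBl mulr_le0_ge0// subr_le0.
by move: gE; rewrite /g; lra.
Qed.

Lemma derive_le0_of_max phi (c : R) :
  is_derive (0 : R) 1 phi c -> (forall t : R, 0 <= t <= 1 -> phi t <= phi 0) -> c <= 0.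
Proof.
move=> /is_derive_cvgP H phimax.
have {}H := cvg_dnbhs_at_right H.
apply: (cvgr_to_le H); near=> h => /=.
have h0 : 0 < h by near: h; exact: nbhs_right_gt.
have h1 : h < 1 by near: h; exact: nbhs_right_lt.
rewrite addr0 [_%:A]mulr1 -[_ *: _]/(_ * _) pmulr_rle0 ?invr_gt0// subr_le0.
by apply: phimax; rewrite !ltW.
Unshelve. all: by end_near. Qed.

(** A maximizer of a strongly concave function over an interval satisfies the
    first-order inequality even at an endpoint, whence quadratic decay. *)
Lemma strong_concave_argmax f (f1 f2 : R -> R) K (a b q p : R) :
  (forall t : R, a <= t <= b -> is_derive t 1 f (f1 t)) ->
  (forall t : R, a <= t <= b -> is_derive t 1 f1 (f2 t)) ->
  (forall t : R, a <= t <= b -> f2 t <= - K) ->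
  a <= q <= b -> a <= p <= b ->
  (forall t : R, a <= t <= b -> f t <= f q) ->
  f p <= f q - K / 2 * (p - q) ^+ 2.
Proof.
move=> d1 d2 bK qab pab qmax.
have seg (t : R) : 0 <= t <= 1 -> a <= q + t * (p - q) <= b by move=> ?; nra.
have D1 (t : R) : 0 <= t <= 1 ->
    is_derive t 1 (fun s => f (q + s * (p - q))) ((p - q) * f1 (q + t * (p - q))).
  by move=> t01; apply: is_derive_segment; exact/d1/seg.
have D2 (t : R) : 0 <= t <= 1 ->
    is_derive t 1 (fun s => (p - q) * f1 (q + s * (p - q)))
      ((p - q) * ((p - q) * f2 (q + t * (p - q)))).
  by move=> t01; apply: is_deriveZ; apply: is_derive_segment; exact/d2/seg.
have le0 : (p - q) * f1 q <= 0.
  have := D1 0; rewrite lexx ler01 mul0r addr0 => /(_ isT).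
  move=> /derive_le0_of_max; apply => t t01; rewrite mul0r addr0.
  exact/qmax/seg.
have K2 t : 0 <= t <= 1 ->
    (p - q) * ((p - q) * f2 (q + t * (p - q))) <= - K * (p - q) ^+ 2.
  by move=> t01; have := bK _ (seg t t01); have := sqr_ge0 (p - q); nra.
have := taylor2_le D1 D2 K2; rewrite mul1r mul0r addr0 subrKC.
by lra.
Qed.

Lemma is_deriv_on_interior f (f1 : R -> R) (x : R) :
  is_deriv_on `[0, 1] f f1 -> 0 < x < 1 -> is_derive x 1 f (f1 x).
Proof.
move=> fd x01; apply/is_derive_cvgP.
have xin : `[0, 1]%classic x by move: x01 => /andP[/ltW x0 /ltW x1]; rewrite /= in_itv/= x0.
have H := fd x xin.
have nx : nbhs x (`]0, 1[%classic : set R).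
  by apply: open_nbhs_nbhs; split; [exact: interval_open|rewrite /= in_itv].
have {}H : (fun y => (f y - f x) / (y - x)) @ x^' --> f1 x.
  have nx' : x^' (`]0, 1[%classic : set R).
    by apply: filterS nx => y yin _.
  move=> A /H HA.
  have {}HA : x^' [set y | `[0, 1]%classic y -> A ((f y - f x) / (y - x))].
    exact: HA.
  apply: filterS2 HA nx' => y /= HA; rewrite in_itv/= => /andP[/ltW y0 /ltW y1].
  by apply: HA; rewrite /= in_itv/= y0.
move/cvgrPdist_lt : H => H; apply/cvgrPdist_lt => e e0.
have {H} := H e e0; rewrite /nbhs /= /dnbhs /within /= /nbhs/=.
move=> [d /= d0 H]; exists d => //= h /= hd h0.
have := H (h + x); rewrite /= opprD addrCA subrr addr0 addrK.
have -> : h%:A + x = h + x by rewrite [_%:A]mulr1.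
rewrite -[_ *: _]/(_ * _) mulrC => -> //; first by rewrite -sub0r.
by rewrite -subr_eq0 addrK.
Qed.

Lemma C2_on_interior f : C2_on `[0, 1] f ->
  exists f1 f2 : R -> R, forall x : R, 0 < x < 1 ->
  [/\ is_derive x 1 f (f1 x), is_derive x 1 f1 (f2 x) & {for x, continuous f2}].
Proof.
move=> [f1 [f2 [d1 d2 c2]]]; exists f1, f2 => x x01.
split; [exact: is_deriv_on_interior d1 x01|exact: is_deriv_on_interior d2 x01|].
have /(continuous_within_itvP _ ltr01)[+ _ _] := c2.
by apply; rewrite in_itv.
Qed.

Lemma derive1n2_interior f (f1 f2 : R -> R) (x : R) :
  (forall y : R, 0 < y < 1 -> is_derive y 1 f (f1 y)) ->
  (forall y : R, 0 < y < 1 -> is_derive y 1 f1 (f2 y)) ->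
  0 < x < 1 -> f^`() x = f1 x /\ f^`(2) x = f2 x.
Proof.
move=> d1 d2 x01; split; first by rewrite derive1E; apply: derive_val; exact: d1.
rewrite derive1nS derive1n1 derive1E.
apply: derive_val; apply: near_eq_is_derive (d2 x x01).
have nx : nbhs x (`]0, 1[%classic : set R).
  by apply: open_nbhs_nbhs; split; [exact: interval_open|rewrite /= in_itv].
apply: filterS nx => y /=; rewrite in_itv/= => y01.
by rewrite derive1E; apply/esym/derive_val; exact: d1.
Qed.
End OneVariable.

(** * Moments of the nominal law *)

Section Moments.
Context {R : realType} {d : nat}.
Variable P : probability (borel R d) R.
Hypothesis P2 : finite_second_moment P.

Definition Exp (f : 'rV[R]_d -> R) : R := fine 'E_P[f : borel R d -> R]%E.

Definition L1 (f : 'rV[R]_d -> R) : Prop := (f : borel R d -> R) \in Lfun P 1.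

Lemma measurable_coord i :
  measurable_fun setT (fun z : borel R d => (z : 'rV[R]_d) 0 i).
Proof.
apply: (measurability _ (RGenOpens.measurableE R)).
move=> _ [_ [a [b ->] <-]]; rewrite setTI; apply: sub_sigma_algebra.
have /continuousP := @coord_continuous R 1 d 0 i.
by apply; exact: interval_open.
Qed.

Lemma measurable_sqr_enorm :
  measurable_fun setT (fun z : borel R d => enorm (z : 'rV[R]_d) ^+ 2).
Proof.
have -> : (fun z : borel R d => enorm (z : 'rV[R]_d) ^+ 2) =
    (fun z => \sum_(i < d) (z : 'rV[R]_d) 0 i * (z : 'rV[R]_d) 0 i).
  by apply/funext => z; rewrite sqr_enorm dot_sum.
apply: measurable_sum => i; apply: measurable_funM; exact: measurable_coord.
Qed.

Lemma integrable_sqr_enorm :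
  P.-integrable setT (fun z : borel R d => (enorm (z : 'rV[R]_d) ^+ 2)%:E).
Proof.
apply/integrableP; split.
  by apply/measurable_EFinP; exact: measurable_sqr_enorm.
move: P2; rewrite /finite_second_moment unlock; congr (_ < _)%E.
by apply: eq_integral => z _ /=; rewrite ger0_norm// exprn_ge0// enorm_ge0.
Qed.

(** A finite second moment makes [1 + |z| ^ 2] an integrable majorant. *)
Lemma L1_of_bound (f : 'rV[R]_d -> R) :
  measurable_fun setT (f : borel R d -> R) ->
  (forall z, `|f z| <= enorm z ^+ 2 + 1) -> L1 f.
Proof.
move=> mf bf; apply/Lfun1_integrable.
apply: (@le_integrable _ _ _ _ _ measurableT _
  (fun z : borel R d => ((enorm (z : 'rV[R]_d) ^+ 2)%:E + 1%:E)%E)).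
- exact/measurable_EFinP.
- move=> z _ /=; rewrite lee_fin; apply: le_trans (bf z) (ler_norm _).
- by apply: integrableD => //; [exact: integrable_sqr_enorm|exact: finite_measure_integrable_cst].
Qed.

Lemma L1_coord i : L1 (fun z => z 0 i).
Proof.
apply: L1_of_bound => [|z]; first exact: measurable_coord.
apply: le_trans (entry_le_enorm _ _) _.
have := sqr_ge0 (enorm z - 1); have := sqr_ge0 (enorm z); lra.
Qed.

Lemma L1_coordM i j : L1 (fun z => z 0 i * z 0 j).
Proof.
apply: L1_of_bound => [|z]; first by apply: measurable_funM; exact: measurable_coord.
apply: (@le_trans _ _ (enorm z ^+ 2)); last lra.
by rewrite normrM expr2 ler_pM// entry_le_enorm.
Qed.

Lemma L1_cst c : L1 (cst c).
Proof. exact: Lfun_cst. Qed.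

Lemma L1Z c f : L1 f -> L1 (fun z => c * f z).
Proof.
move=> Lf; have -> : (fun z => c * f z) = (c \o* f).
  by apply/funext => z /=; rewrite mulrC.
exact: Lfun_scale.
Qed.

Lemma L1D f g : L1 f -> L1 g -> L1 (fun z => f z + g z).
Proof. by move=> Lf Lg; exact: (rpredD Lf Lg). Qed.

Lemma ExpZ c f : L1 f -> Exp (fun z => c * f z) = c * Exp f.
Proof.
move=> Lf; have -> : (fun z => c * f z) = (c \o* f).
  by apply/funext => z /=; rewrite mulrC.
by rewrite /Exp expectationZl// fineM// expectation_fin_num.
Qed.

Lemma ExpD f g : L1 f -> L1 g -> Exp (fun z => f z + g z) = Exp f + Exp g.
Proof.
by move=> Lf Lg; rewrite /Exp expectationD// fineD// expectation_fin_num.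
Qed.

Lemma Exp_cst c : Exp (cst c) = c.
Proof. by rewrite /Exp expectation_cst. Qed.

Lemma L1_Exp_sum n (F : 'I_n -> 'rV[R]_d -> R) : (forall i, L1 (F i)) ->
  L1 (fun z => \sum_i F i z) /\ Exp (fun z => \sum_i F i z) = \sum_i Exp (F i).
Proof.
elim: n F => [|n IH] F LF.
  have -> : (fun z => \sum_(i < 0) F i z) = cst 0.
    by apply/funext => z; rewrite big_ord0.
  by rewrite big_ord0 Exp_cst; split => //; exact: L1_cst.
have [L E] := IH (fun i => F (widen_ord (leqnSn n) i)) (fun i => LF _).
have -> : (fun z => \sum_(i < n.+1) F i z) =
    (fun z => \sum_(i < n) F (widen_ord (leqnSn n) i) z + F ord_max z).
  by apply/funext => z; rewrite big_ord_recr.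
by rewrite ExpD// E big_ord_recr/=; split=> //; exact: L1D.
Qed.

Lemma meanvE i : meanv P 0 i = Exp (fun z => z 0 i).
Proof. by rewrite mxE. Qed.

Lemma covmxE i j :
  covmx P i j = Exp (fun z => z 0 i * z 0 j) - meanv P 0 i * meanv P 0 j.
Proof.
rewrite mxE covarianceE; [|exact: L1_coord|exact: L1_coord|exact: L1_coordM].
have fi k := expectation_fin_num (L1_coord k).
have fij := expectation_fin_num (L1_coordM i j).
rewrite fineB ?fin_numM// fineM//.
by rewrite !meanvE.
Qed.

(** Expanding the square, the expected loss becomes an explicit quadratic
    polynomial in [(x, a)], free of integrals. *)
Lemma expectation_psi gamma a (x : 'rV[R]_d) :
  fine 'E_P[fun z : 'rV[R]_d => psi gamma a (dot x z)]%E =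
  dot (x *m (covmx P + (meanv P)^T *m meanv P)) x
  - 2 * a * dot x (meanv P) + a ^+ 2 - gamma * dot x (meanv P).
Proof.
have L2 i : L1 (fun z => \sum_j x 0 i * x 0 j * (z 0 i * z 0 j)) /\
    Exp (fun z => \sum_j x 0 i * x 0 j * (z 0 i * z 0 j)) =
    \sum_j x 0 i * x 0 j * (covmx P i j + meanv P 0 i * meanv P 0 j).
  have [|L ->] := @L1_Exp_sum d (fun j z => x 0 i * x 0 j * (z 0 i * z 0 j)).
    by move=> j; apply/L1Z/L1_coordM.
  split=> //; apply: eq_bigr => j _; rewrite ExpZ; last exact: L1_coordM.
  by rewrite covmxE subrK.
have [|LQ EQ] := @L1_Exp_sum d (fun i z => \sum_j x 0 i * x 0 j * (z 0 i * z 0 j)).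
  by move=> i; have [] := L2 i.
have [|LL EL] := @L1_Exp_sum d (fun i z => x 0 i * z 0 i).
  by move=> i; apply/L1Z/L1_coord.
have -> : (fun z : 'rV[R]_d => psi gamma a (dot x z)) =
    (fun z => (\sum_i \sum_j x 0 i * x 0 j * (z 0 i * z 0 j) +
      - (2 * a + gamma) * (\sum_i x 0 i * z 0 i)) + cst (a ^+ 2) z).
  apply/funext => z; rewrite /psi dot_sum.
  have -> : \sum_i \sum_j x 0 i * x 0 j * (z 0 i * z 0 j) =
      (\sum_i x 0 i * z 0 i) ^+ 2.
    rewrite expr2 mulr_suml; apply: eq_bigr => i _; rewrite mulr_sumr.
    by apply: eq_bigr => j _; ring.
  by rewrite /=; ring.
rewrite -/(Exp _) ExpD; [|exact/L1D/L1Z|exact: L1_cst].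
rewrite ExpD; [|by []|exact: L1Z].
rewrite ExpZ// Exp_cst EQ EL.
have -> : \sum_i Exp (fun z => x 0 i * z 0 i) = dot x (meanv P).
  rewrite dot_sum; apply: eq_bigr => i _.
  by rewrite ExpZ ?meanvE//; exact: L1_coord.
have -> : \sum_i Exp (fun z => \sum_j x 0 i * x 0 j * (z 0 i * z 0 j)) =
    dot (x *m (covmx P + (meanv P)^T *m meanv P)) x.
  rewrite dot_mulmx; apply: eq_bigr => i _; have [_ ->] := L2 i.
  apply: eq_bigr => j _; rewrite [in RHS]mxE.
  by congr (_ * (_ + _)); rewrite [in RHS]mxE big_ord1 [_^T _ _]mxE.
by ring.
Qed.

End Moments.

(** * Quadratic functions and their square roots *)

Section Quadratic.
Context {R : realType}.

(** Directional derivatives only see the restriction to a line, where the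
    chain rule for the square root is the one-variable one. *)
Lemma is_derive_lineI (V : normedModType R) (f : V -> R) (z v : V) (df : R) :
  is_derive (0 : R) 1 (fun s : R => f (z + s *: v)) df -> is_derive z v f df.
Proof.
move=> /is_derive_cvgP H; apply/is_derive_cvgP; apply: cvg_trans H.
apply: near_eq_cvg; near=> h => /=.
by rewrite [_%:A]mulr1 addr0 scale0r addr0 (addrC z).
Unshelve. all: by end_near. Qed.

(** A quadratic function on a vector space, given with half its differential
    [qpol] and half its second differential [qbil]. *)
Record quadratic (V : lmodType R) := Quadratic {
  qval :> V -> R;
  qpol : V -> V -> R;
  qbil : V -> V -> R;
  qval_line : forall z v t,
    qval (z + t *: v) = qval z + 2 * t * qpol z v + t ^+ 2 * qbil v v;
  qpol_line : forall z u v t, qpol (z + t *: u) v = qpol z v + t * qbil u v;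
  qpol_lin : forall z t u v, qpol z (t *: u + v) = t * qpol z u + qpol z v }.

Lemma qvalD (V : lmodType R) (Q : quadratic V) z v :
  Q (z + v) = Q z + 2 * qpol Q z v + qbil Q v v.
Proof. by rewrite -[in LHS](scale1r v) qval_line; ring. Qed.

Lemma qbil_linr (V : lmodType R) (Q : quadratic V) t u v w :
  qbil Q w (t *: u + v) = t * qbil Q w u + qbil Q w v.
Proof.
have E x : qbil Q w x = qpol Q w x - qpol Q 0 x.
  by have := qpol_line Q 0 w x 1; rewrite scale1r add0r => ->; ring.
by rewrite !E !qpol_lin; ring.
Qed.

Lemma qbil_linl (V : lmodType R) (Q : quadratic V) t u v w :
  qbil Q (t *: u + v) w = t * qbil Q u w + qbil Q v w.
Proof.
have := qpol_line Q v u w t; have := qpol_line Q 0 v w 1.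
have := qpol_line Q 0 (t *: u + v) w 1.
rewrite !scale1r !add0r (addrC v) => -> ->; lra.
Qed.

(** The Cauchy-Schwarz inequality between the values at [z] and [z + v] of the
    affine map whose squared norm is [Q]. *)
Definition sqnorm_like (V : lmodType R) (Q : quadratic V) : Prop :=
  forall z v, Q z + qpol Q z v <= Num.sqrt (Q z) * Num.sqrt (Q (z + v)).

Context {V : normedModType R}.
Implicit Types (Q : quadratic V) (z u v : V).

Lemma is_derive_qval_line Q z v (t : R) :
  is_derive t 1 (fun s : R => Q (z + s *: v)) (2 * qpol Q (z + t *: v) v).
Proof.
have -> : (fun s : R => Q (z + s *: v)) =
    (fun s => Q z + s * (2 * qpol Q z v) + s ^+ 2 * qbil Q v v).
  by apply/funext => s; rewrite qval_line; ring.
rewrite qpol_line; apply: is_derive_eq.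
by rewrite /GRing.scale/=; ring.
Qed.

Lemma is_derive_qpol_line Q z u v (t : R) :
  is_derive t 1 (fun s : R => qpol Q (z + s *: u) v) (qbil Q u v).
Proof.
have -> : (fun s : R => qpol Q (z + s *: u) v) =
    (fun s => qpol Q z v + s * qbil Q u v).
  by apply/funext => s; rewrite qpol_line.
by apply: is_derive_eq; rewrite /GRing.scale/=; ring.
Qed.

(** Keeps the square root differentiable at the neighbouring points, which
    iterated derivatives require. *)
Lemma near_qval_gt0 Q z v : 0 < Q z -> \forall s \near (0 : R), 0 < Q (z + s *: v).
Proof.
move=> Qz.
have /derivable1_diffP/differentiable_continuous :=
  @ex_derive _ _ _ _ _ _ _ (is_derive_qval_line Q z v 0).
move=> /cvgrPdist_lt/(_ _ Qz); rewrite scale0r addr0.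
by apply: filterS => s; rewrite ltr_norml => /andP[_]; lra.
Qed.

Definition qroot Q z : R := Num.sqrt (Q z).
Definition qroot1 Q z v : R := qpol Q z v / qroot Q z.
Definition qroot2 Q z u v : R :=
  qbil Q u v / qroot Q z - qpol Q z u * qpol Q z v / qroot Q z ^+ 3.

Lemma qroot_gt0 Q z : 0 < Q z -> 0 < qroot Q z.
Proof. by rewrite sqrtr_gt0. Qed.

Lemma is_derive_qroot_line Q z v (t : R) : 0 < Q (z + t *: v) ->
  is_derive t 1 (fun s : R => qroot Q (z + s *: v)) (qroot1 Q (z + t *: v) v).
Proof.
move=> Qz; have dQ := is_derive_qval_line Q z v t.
apply: (is_derive_eq (@is_derive1_comp R Num.sqrt (fun s : R => Q (z + s *: v))
  t _ _ (is_derive1_sqrt Qz) dQ)).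
rewrite /qroot1 /qroot; field.
by rewrite gt_eqF// sqrtr_gt0.
Qed.

Lemma is_derive_qroot1_line Q z u v (t : R) : 0 < Q (z + t *: u) ->
  is_derive t 1 (fun s : R => qroot1 Q (z + s *: u) v)
    (qroot2 Q (z + t *: u) u v).
Proof.
move=> Qz; have dQ := is_derive_qroot_line Qz.
have dp := is_derive_qpol_line Q z u v t.
have r0 : qroot Q (z + t *: u) != 0 by rewrite gt_eqF// qroot_gt0.
have dV := @is_deriveV R (fun s : R => qroot Q (z + s *: u)) t _ 1 r0 dQ.
apply: (is_derive_eq (is_deriveM dp dV)).
by rewrite /qroot2 /qroot1 /GRing.scale/=; field.
Qed.

End Quadratic.

(** * The objective as a function of the parameter and the decision *)

Section Objective.
Context {R : realType} {V : normedModType R}.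
Variables (A N S : quadratic V) (la : V -> R) (gamma kappa : R) (r r1 r2 : R -> R).
Hypothesis la_lin : forall t u v, la (t *: u + v) = t * la u + la v.

Definition swing (q : R) z := r q * qroot N z + qroot S z.
Definition swing1 (q : R) z v := r q * qroot1 N z v + qroot1 S z v.
Definition swing2 (q : R) z u v := r q * qroot2 N z u v + qroot2 S z u v.

Definition obj (q : R) z :=
  (1 - q) * A z + q * (swing q z ^+ 2 - gamma * la z - kappa).
Definition obj1 (q : R) z v :=
  (1 - q) * (2 * qpol A z v) +
  q * (2 * swing q z * swing1 q z v - gamma * la v).
Definition obj2 (q : R) z u v :=
  (1 - q) * (2 * qbil A u v) +
  q * (2 * (swing1 q z u * swing1 q z v + swing q z * swing2 q z u v)).
Definition obj_q (q : R) z :=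
  - A z + (swing q z ^+ 2 - gamma * la z - kappa) +
  q * (2 * swing q z * (r1 q * qroot N z)).
Definition obj_qq (q : R) z :=
  2 * swing q z * qroot N z * (2 * r1 q + q * r2 q) +
  2 * q * (r1 q * qroot N z) ^+ 2.
Definition obj1_q (q : R) z v :=
  - (2 * qpol A z v) + (2 * swing q z * swing1 q z v - gamma * la v) +
  q * (2 * r1 q * (qroot N z * swing1 q z v + swing q z * qroot1 N z v)).

Implicit Types (z u v : V).

Lemma la_line z t v : la (z + t *: v) = la z + t * la v.
Proof. by rewrite addrC la_lin addrC. Qed.

Lemma is_derive_obj_line q z v (t : R) :
  0 < N (z + t *: v) -> 0 < S (z + t *: v) ->
  is_derive t 1 (fun s : R => obj q (z + s *: v)) (obj1 q (z + t *: v) v).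
Proof.
move=> Nz Sz; have dA := is_derive_qval_line A z v t.
have dN := is_derive_qroot_line Nz; have dS := is_derive_qroot_line Sz.
have -> : (fun s : R => obj q (z + s *: v)) = (fun s : R =>
    (1 - q) * A (z + s *: v) +
    q * ((r q * qroot N (z + s *: v) + qroot S (z + s *: v)) ^+ 2 -
         gamma * (la z + s * la v) - kappa)).
  by apply/funext => s; rewrite /obj /swing la_line.
apply: is_derive_eq; rewrite /obj1 /swing /swing1 /GRing.scale/=; ring.
Qed.

Lemma is_derive_obj1_line q z u v (t : R) :
  0 < N (z + t *: u) -> 0 < S (z + t *: u) ->
  is_derive t 1 (fun s : R => obj1 q (z + s *: u) v) (obj2 q (z + t *: u) u v).
Proof.
move=> Nz Sz; have dA := is_derive_qpol_line A z u v t.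
have dN := is_derive_qroot_line Nz; have dS := is_derive_qroot_line Sz.
have dN1 := is_derive_qroot1_line v Nz; have dS1 := is_derive_qroot1_line v Sz.
rewrite /obj1 /swing /swing1.
by apply: is_derive_eq; rewrite /obj2 /swing /swing1 /swing2 /GRing.scale/=; ring.
Qed.

Lemma is_derive_obj q z v : 0 < N z -> 0 < S z ->
  is_derive z v (obj q) (obj1 q z v).
Proof.
move=> Nz Sz; apply: is_derive_lineI.
have zE : z + 0 *: v = z by rewrite scale0r addr0.
by have := @is_derive_obj_line q z v 0; rewrite zE; exact.
Qed.

(** Only the values along the line through [z] matter, and both squared norms
    stay positive on it near [z], so the inner derivative may be replaced by
    its formula. *)
Lemma derive_derive_obj q z u v : 0 < N z -> 0 < S z ->
  'D_u ('D_v (obj q)) z = obj2 q z u v.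
Proof.
move=> Nz Sz; apply: derive_val; apply: is_derive_lineI.
have zE : z + 0 *: u = z by rewrite scale0r addr0.
have := @is_derive_obj1_line q z u v 0; rewrite zE => /(_ Nz Sz).
apply: near_eq_is_derive.
apply: filterS2 (near_qval_gt0 u Nz) (near_qval_gt0 u Sz) => s Ns Ss.
by apply/esym/derive_val; exact: is_derive_obj.
Qed.

Lemma is_derive_obj_q (q : R) z : is_derive q 1 r (r1 q) ->
  is_derive q 1 (fun p : R => obj p z) (obj_q q z).
Proof.
move=> dr; rewrite /obj /swing.
by apply: is_derive_eq; rewrite /obj_q /swing /GRing.scale/=; ring.
Qed.

Lemma is_derive_obj_qq (q : R) z :
  is_derive q 1 r (r1 q) -> is_derive q 1 r1 (r2 q) ->
  is_derive q 1 (fun p : R => obj_q p z) (obj_qq q z).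
Proof.
move=> dr dr1; rewrite /obj_q /swing.
by apply: is_derive_eq; rewrite /obj_qq /swing /GRing.scale/=; ring.
Qed.

Lemma is_derive_obj1_q (q : R) z v : is_derive q 1 r (r1 q) ->
  is_derive q 1 (fun p : R => obj1 p z v) (obj1_q q z v).
Proof.
move=> dr; rewrite /obj1 /swing /swing1.
by apply: is_derive_eq; rewrite /obj1_q /swing /swing1 /GRing.scale/=; ring.
Qed.

Lemma qroot1_lin (Q : quadratic V) z t u v :
  qroot1 Q z (t *: u + v) = t * qroot1 Q z u + qroot1 Q z v.
Proof. by rewrite /qroot1 qpol_lin; ring. Qed.

Lemma obj1_lin q z t u v :
  obj1 q z (t *: u + v) = t * obj1 q z u + obj1 q z v.
Proof. by rewrite /obj1 /swing1 !qroot1_lin qpol_lin la_lin; ring. Qed.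

Lemma obj1_q_lin q z t u v :
  obj1_q q z (t *: u + v) = t * obj1_q q z u + obj1_q q z v.
Proof. by rewrite /obj1_q /swing1 !qroot1_lin qpol_lin la_lin; ring. Qed.

Lemma obj2_linl q z t u v w :
  obj2 q z (t *: u + v) w = t * obj2 q z u w + obj2 q z v w.
Proof.
rewrite /obj2 /swing2 /swing1 /qroot2 /qroot1.
by rewrite !qpol_lin !qbil_linl; ring.
Qed.

Lemma obj2_linr q z t u v w :
  obj2 q z w (t *: u + v) = t * obj2 q z w u + obj2 q z w v.
Proof.
rewrite /obj2 /swing2 /swing1 /qroot2 /qroot1.
by rewrite !qpol_lin !qbil_linr; ring.
Qed.

(** The worst-case part is the square of the convex nonnegative [swing], so
    by Cauchy-Schwarz it lies above its tangent [s ^ 2 + 2 s (l - s)], where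
    [l <= swing (z + v)]; the curvature of the nominal part [A] is kept. *)
Lemma obj_tangent_le q z v :
  sqnorm_like N -> sqnorm_like S -> 0 <= q -> 0 <= r q -> 0 < N z -> 0 < S z ->
  obj q z + obj1 q z v + (1 - q) * qbil A v v <= obj q (z + v).
Proof.
move=> csN csS q0 rq0 Nz Sz.
have nz := qroot_gt0 Nz; have sz := qroot_gt0 Sz.
have tangent (Q : quadratic V) : sqnorm_like Q -> 0 < Q z ->
    qroot Q z + qroot1 Q z v <= qroot Q (z + v).
  move=> csQ Qz; have Qr := qroot_gt0 Qz.
  rewrite -(ler_pM2l Qr); apply: le_trans (csQ z v).
  have -> : Q z = qroot Q z ^+ 2 by rewrite sqr_sqrtr// ltW.
  suff -> : qroot Q z * (qroot Q z + qroot1 Q z v) =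
      qroot Q z ^+ 2 + qpol Q z v by [].
  by rewrite /qroot1; field; rewrite gt_eqF.
have s0 : 0 <= swing q z by rewrite addr_ge0 ?mulr_ge0// ltW.
have sle : swing q z + swing1 q z v <= swing q (z + v).
  have := tangent _ csN Nz; have := tangent _ csS Sz.
  rewrite /swing /swing1 => tS tN.
  have := ler_wpM2l rq0 tN; lra.
have sq : swing q z ^+ 2 + 2 * swing q z * swing1 q z v <= swing q (z + v) ^+ 2.
  have := ler_wpM2l s0 sle; have := sqr_ge0 (swing q (z + v) - swing q z); nra.
have := ler_wpM2l q0 sq.
have := la_line z 1 v; rewrite scale1r mul1r => laD.
by rewrite /obj /obj1 qvalD laD; lra.
Qed.

(** Near a critical point of [r] with [r'' < 0], concavity in [q] does not
    degrade as [swing] grows: its coefficient [2 r' + q r''] is nonpositive,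
    so [swing] may be replaced by its lower bound [r * qroot N]. *)
Lemma obj_qq_le q z (c : R) : 0 <= r q -> 0 <= q ->
  2 * r1 q + q * r2 q <= 0 ->
  2 * r q * (2 * r1 q + q * r2 q) + 2 * q * r1 q ^+ 2 <= - c ->
  0 <= N z -> obj_qq q z <= - c * N z.
Proof.
move=> rq q0 neg le_c Nz.
have n0 : 0 <= qroot N z := sqrtr_ge0 _.
have s0 : 0 <= qroot S z := sqrtr_ge0 _.
have -> : N z = qroot N z ^+ 2 by rewrite sqr_sqrtr.
rewrite /obj_qq /swing.
have := ler_wpM2r (sqr_ge0 (qroot N z)) le_c.
have : qroot S z * qroot N z * (2 * r1 q + q * r2 q) <= 0.
  by rewrite mulr_ge0_le0// mulr_ge0.
nra.
Qed.

End Objective.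

(** * Gradient, Hessian and descent *)

Section RowObjective.
Context {R : realType} {m : nat}.
Variables (A N S : quadratic 'rV[R]_m) (la : 'rV[R]_m -> R) (gamma kappa : R).
Variables (r r1 r2 : R -> R).
Hypothesis la_lin : forall t u v, la (t *: u + v) = t * la u + la v.
Variables (lo hi : R) (D : set 'rV[R]_m).
Hypothesis r_der : forall q : R, lo <= q <= hi -> is_derive q 1 r (r1 q).
Hypothesis r1_der : forall q : R, lo <= q <= hi -> is_derive q 1 r1 (r2 q).
Hypothesis D_pos : exists2 c, 0 < c & forall z, D z -> c <= N z /\ c <= S z.

Local Notation f := (obj A N S la gamma kappa r).
Local Notation f1 := (obj1 A N S la gamma r).
Local Notation f2 := (obj2 A N S r).
Local Notation f_q := (obj_q A N S la gamma kappa r r1).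
Local Notation f_qq := (obj_qq N S r r1 r2).
Local Notation f1_q := (obj1_q A N S la gamma r r1).
Local Notation e_ i := (delta_mx 0 i : 'rV[R]_m).

Lemma linear_sum (F : 'rV[R]_m -> R) v :
  (forall t u w, F (t *: u + w) = t * F u + F w) ->
  F v = \sum_i v 0 i * F (e_ i).
Proof.
move=> lF; have F0 : F 0 = 0.
  by have := lF (-1) 0 0; rewrite scaler0 addr0; lra.
rewrite {1}(row_sum_delta v); elim/big_ind2 : _ => //.
  by move=> a u b w <- <-; have := lF 1 u w; rewrite scale1r mul1r.
by move=> i _; have := lF (v 0 i) (e_ i) 0; rewrite addr0 F0 addr0.
Qed.

Lemma N_gt0 z : D z -> 0 < N z.
Proof. by case: D_pos => c c0 H /H[Nc _]; exact: lt_le_trans Nc. Qed.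

Lemma S_gt0 z : D z -> 0 < S z.
Proof. by case: D_pos => c c0 H /H[_ Sc]; exact: lt_le_trans Sc. Qed.

Lemma dot_grad q z v : D z -> dot (grad (f q) z) v = f1 q z v.
Proof.
move=> Dz; rewrite (linear_sum v (obj1_lin _ _ _ _ _ la_lin q z)) dot_sum.
apply: eq_bigr => i _; rewrite mxE mulrC; congr (_ * _).
by apply: derive_val; apply: is_derive_obj => //; [exact: N_gt0|exact: S_gt0].
Qed.

Lemma hessianE q z i j : D z -> hessian (f q) z i j = f2 q z (e_ i) (e_ j).
Proof.
by move=> Dz; rewrite mxE derive_derive_obj//; [exact: N_gt0|exact: S_gt0].
Qed.

Lemma dot_hessian q z v : D z -> dot (v *m (hessian (f q) z)^T) v = f2 q z v v.
Proof.
move=> Dz; rewrite dot_mulmx [RHS](linear_sum v); last first.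
  by move=> t u w; exact: obj2_linr.
apply: eq_bigr => i _.
rewrite (@linear_sum (fun u => f2 q z u (e_ i)) v); last first.
  by move=> t u w; exact: obj2_linl.
rewrite mulr_sumr; apply: eq_bigr => j _.
by rewrite mxE hessianE// mulrA.
Qed.

Definition mixed (q : R) z : 'rV[R]_m := \row_i (fun p : R => grad (f p) z 0 i)^`() q.

Lemma mixedE q z i : lo <= q <= hi -> D z -> mixed q z 0 i = f1_q q z (e_ i).
Proof.
move=> qB Dz; rewrite mxE derive1E.
have -> : (fun p : R => grad (f p) z 0 i) = (fun p : R => f1 p z (e_ i)).
  apply/funext => p; rewrite mxE; apply: derive_val; apply: is_derive_obj => //.
    exact: N_gt0.
  exact: S_gt0.
by apply: derive_val; apply: is_derive_obj1_q; exact: r_der.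
Qed.

Lemma dot_mixed q z v : lo <= q <= hi -> D z -> dot (mixed q z) v = f1_q q z v.
Proof.
move=> qB Dz; rewrite (linear_sum v (obj1_q_lin _ _ _ _ _ _ la_lin q z)) dot_sum.
by apply: eq_bigr => i _; rewrite mixedE// mulrC.
Qed.

(** The maximizing parameter at [z + v] differs from the one at [z].  Using [p]
    in place of [q] changes the slope along [v] by at most [K3 |p - q| |v|],
    and strong concavity in the parameter pays this back up to
    [K3 ^ 2 / (2 K4) |v| ^ 2].  No differentiability of the maximum itself is
    involved. *)
Lemma descent K2 K3 K4 q p z v :
  (forall u w t, D u -> D w -> 0 <= t <= 1 -> D (u + t *: (w - u))) ->
  (forall q z, lo <= q <= hi -> D z -> opnorm2 (hessian (f q) z) <= K2) ->
  (forall q z, lo <= q <= hi -> D z -> enorm (mixed q z) <= K3) ->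
  (forall q z, lo <= q <= hi -> D z -> f_qq q z <= - K4) ->
  0 < K4 -> D z -> D (z + v) -> lo <= q <= hi -> lo <= p <= hi ->
  (forall p, lo <= p <= hi -> f p z <= f q z) ->
  f p (z + v) <= f q z + dot (grad (f q) z) v +
                 (K3 ^+ 2 + K2 * K4) / K4 / 2 * dot v v.
Proof.
move=> cD hK2 hK3 hK4 K4_gt0 Dz Dzv qB pB qmax; rewrite dot_grad//.
have seg (t : R) : 0 <= t <= 1 -> D (z + t *: v).
  by move=> t01; have := cD _ _ _ Dz Dzv t01; rewrite [z + v]addrC addrK.
have d1 (t : R) : 0 <= t <= 1 ->
    is_derive t 1 (fun s : R => f p (z + s *: v)) (f1 p (z + t *: v) v).
  by move=> /seg Dt; apply: is_derive_obj_line => //; [exact: N_gt0|exact: S_gt0].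
have d2 (t : R) : 0 <= t <= 1 ->
    is_derive t 1 (fun s : R => f1 p (z + s *: v) v) (f2 p (z + t *: v) v v).
  by move=> /seg Dt; apply: is_derive_obj1_line => //; [exact: N_gt0|exact: S_gt0].
have b2 (t : R) : 0 <= t <= 1 -> f2 p (z + t *: v) v v <= K2 * dot v v.
  move=> /seg Dt; rewrite -dot_hessian//; apply: le_trans (dot_mulmx_le_opnorm2 _ _) _.
  by rewrite ler_wpM2r ?dot_ge0//; exact: hK2.
have := taylor2_le d1 d2 b2; rewrite scale1r scale0r addr0 => taylor.
have segq (t : R) : 0 <= t <= 1 -> lo <= q + t * (p - q) <= hi by move=> ?; nra.
have conc : f p z <= f q z - K4 / 2 * (p - q) ^+ 2.
  apply: (@strong_concave_argmax _ (fun p => f p z) (fun p => f_q p z)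
    (fun p => f_qq p z) K4 lo hi) => // t tB.
  - exact/is_derive_obj_q/r_der.
  - by apply: is_derive_obj_qq; [exact: r_der|exact: r1_der].
  - exact: hK4.
have dm (t : R) : 0 <= t <= 1 ->
    is_derive t 1 (fun s : R => f1 (q + s * (p - q)) z v)
      ((p - q) * f1_q (q + t * (p - q)) z v).
  move=> t01; apply: (@is_derive_segment _ (fun q => f1 q z v)).
  exact/is_derive_obj1_q/r_der/segq.
have [c c01] := MVT_ge0 ler01 dm.
rewrite mul1r mul0r addr0 subrKC mulr1 => mvt.
have mle : f1 p z v - f1 q z v <= K3 * (`|p - q| * enorm v).
  rewrite mvt -dot_mixed ?segq// -dotZr.
  apply: le_trans (dot_le_enorm _ _) _; rewrite enormZ.
  rewrite ler_wpM2r ?mulr_ge0 ?enorm_ge0//.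
  by apply: hK3 => //; exact: segq.
have amgm : K3 * (`|p - q| * enorm v) <=
    K4 / 2 * (p - q) ^+ 2 + K3 ^+ 2 / K4 / 2 * dot v v.
  rewrite -sqr_enorm -[(p - q) ^+ 2]real_normK ?num_real// -subr_ge0.
  have -> : K4 / 2 * `|p - q| ^+ 2 + K3 ^+ 2 / K4 / 2 * enorm v ^+ 2 -
      K3 * (`|p - q| * enorm v) =
      (K4 * `|p - q| - K3 * enorm v) ^+ 2 / (2 * K4).
    by field; rewrite gt_eqF.
  by rewrite divr_ge0 ?sqr_ge0// mulr_ge0// ltW.
have -> : (K3 ^+ 2 + K2 * K4) / K4 / 2 * dot v v =
    K3 ^+ 2 / K4 / 2 * dot v v + K2 * dot v v / 2.
  by field; rewrite gt_eqF.
lra.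
Qed.

(** Functions bounded for [q] in the interval and [z] in [D] form a ring; the
    objective and its derivatives are polynomial in coordinates of [z], in
    [q], [r], [r'], the two square roots and their inverses, so their
    boundedness is checked on these generators. *)
Definition bnd (F : R -> 'rV[R]_m -> R) : Prop :=
  exists C, forall q z, lo <= q <= hi -> D z -> `|F q z| <= C.

Lemma bnd_cst c : bnd (fun _ _ => c).
Proof. by exists `|c|. Qed.

Lemma bndD F G : bnd F -> bnd G -> bnd (fun q z => F q z + G q z).
Proof.
move=> [C HC] [C' HC']; exists (C + C') => q z qB Dz.
by apply: le_trans (ler_normD _ _) _; rewrite lerD ?HC ?HC'.
Qed.

Lemma bndM F G : bnd F -> bnd G -> bnd (fun q z => F q z * G q z).
Proof.
move=> [C HC] [C' HC']; exists (C * C') => q z qB Dz.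
by rewrite normrM ler_pM ?HC ?HC'.
Qed.

Lemma bndN F : bnd F -> bnd (fun q z => - F q z).
Proof. by move=> [C HC]; exists C => q z qB Dz; rewrite normrN HC. Qed.

Lemma bnd_sum (I : finType) (F : I -> R -> 'rV[R]_m -> R) :
  (forall i, bnd (F i)) -> bnd (fun q z => \sum_i F i q z).
Proof.
move=> bF; pose C i := projT1 (cid (bF i)).
exists (\sum_i C i) => q z qB Dz; apply: le_trans (ler_norm_sum _ _ _) _.
by apply: ler_sum => i _; rewrite /C; case: cid => //= c; exact.
Qed.

Hypothesis D_bounded : forall i, bnd (fun _ z => z 0 i).

Lemma bnd_linear (F : 'rV[R]_m -> R) :
  (forall t u w, F (t *: u + w) = t * F u + F w) -> bnd (fun _ z => F z).
Proof.
move=> lF; have [C HC] : bnd (fun _ z => \sum_i z 0 i * F (e_ i)).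
  by apply: bnd_sum => i; apply: bndM; [exact: D_bounded|exact: bnd_cst].
by exists C => q z qB Dz; rewrite (linear_sum z lF); exact: HC qB Dz.
Qed.

Lemma bnd_qpol (Q : quadratic 'rV[R]_m) v : bnd (fun _ z => qpol Q z v).
Proof.
have [C HC] : bnd (fun _ z => qpol Q 0 v + qbil Q z v).
  apply: bndD; first exact: bnd_cst.
  by apply: (@bnd_linear (fun z => qbil Q z v)) => t u w; exact: qbil_linl.
exists C => q z qB Dz; have := qpol_line Q 0 z v 1.
by rewrite scale1r add0r mul1r => ->; exact: HC qB Dz.
Qed.

Lemma bnd_qval (Q : quadratic 'rV[R]_m) : bnd (fun _ z => Q z).
Proof.
have [C HC] : bnd (fun _ z => Q 0 + 2 * qpol Q 0 z +
    \sum_i z 0 i * qbil Q z (e_ i)).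
  apply: bndD.
    apply: bndD; first exact: bnd_cst.
    apply: bndM; first exact: bnd_cst.
    by apply: bnd_linear => t u w; exact: qpol_lin.
  apply: bnd_sum => i; apply: bndM; first exact: D_bounded.
  by apply: (@bnd_linear (fun z => qbil Q z (e_ i))) => t u w; exact: qbil_linl.
exists C => q z qB Dz; have := qvalD Q 0 z; rewrite add0r => ->.
rewrite [X in _ + X](linear_sum z); last by move=> t u w; exact: qbil_linr.
exact: HC qB Dz.
Qed.

Lemma bnd_qroot (Q : quadratic 'rV[R]_m) : bnd (fun _ z => qroot Q z).
Proof.
have [C HC] := bnd_qval Q; exists (Num.sqrt C) => q z qB Dz.
rewrite ger0_norm ?sqrtr_ge0// ler_wsqrtr//.
exact: le_trans (ler_norm _) (HC q z qB Dz).
Qed.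

Lemma bnd_qrootV (Q : quadratic 'rV[R]_m) c :
  0 < c -> (forall z, D z -> c <= Q z) -> bnd (fun _ z => (qroot Q z)^-1).
Proof.
move=> c0 cQ; exists (Num.sqrt c)^-1 => q z qB Dz.
have := cQ z Dz => cz; have Qz := lt_le_trans c0 cz.
rewrite ger0_norm ?invr_ge0 ?sqrtr_ge0// lef_pV2 ?posrE ?sqrtr_gt0//.
exact: ler_wsqrtr.
Qed.

Lemma bnd_param (g g' : R -> R) :
  (forall t : R, lo <= t <= hi -> is_derive t 1 g (g' t)) -> bnd (fun q _ => g q).
Proof.
move=> dg; have [lohi|hilo] := leP lo hi; last first.
  by exists 0 => q z /andP[lq qh] _; have := le_trans lq qh; rewrite leNgt hilo.
have cg := is_derive_within_continuous dg.
have [c _ cM] := EVT_max lohi cg; have [b _ bm] := EVT_min lohi cg.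
exists (`|g c| + `|g b|) => q z qB _.
have := cM q; have := bm q; rewrite !in_itv/= qB => /(_ isT) h1 /(_ isT) h2.
rewrite ler_norml; have := ler_norm (g c); have := lerNnormlW (lexx `|g b|).
have := normr_ge0 (g c); have := normr_ge0 (g b); lra.
Qed.

Lemma bnd_id : bnd (fun q _ => q).
Proof. by apply: (@bnd_param id (fun=> 1)) => t _; exact: is_derive_id. Qed.

Lemma bnd_qrootV_of_pos :
  bnd (fun _ z => (qroot N z)^-1) /\ bnd (fun _ z => (qroot S z)^-1).
Proof.
have [c c0 cD] := D_pos.
by split; apply: (@bnd_qrootV _ c) => // z /cD[].
Qed.

Lemma bnd_qroot1 (Q : quadratic 'rV[R]_m) v :
  bnd (fun _ z => (qroot Q z)^-1) -> bnd (fun _ z => qroot1 Q z v).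
Proof. by move=> bV; apply: bndM => //; exact: bnd_qpol. Qed.

Lemma bnd_qroot2 (Q : quadratic 'rV[R]_m) u v :
  bnd (fun _ z => (qroot Q z)^-1) -> bnd (fun _ z => qroot2 Q z u v).
Proof.
move=> bV; have bp := bnd_qpol Q.
have [C HC] : bnd (fun _ z => qbil Q u v * (qroot Q z)^-1 +
    - (qpol Q z u * qpol Q z v *
       ((qroot Q z)^-1 * ((qroot Q z)^-1 * (qroot Q z)^-1)))).
  apply: bndD; first by apply: bndM => //; exact: bnd_cst.
  by apply: bndN; apply: bndM; apply: bndM => //; exact: bndM.
exists C => q z qB Dz; apply: le_trans (HC q z qB Dz).
by rewrite /qroot2 !exprS expr0 mulr1 !invfM.
Qed.

Lemma bnd_r : bnd (fun q _ => r q).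
Proof. exact: bnd_param r_der. Qed.

Lemma bnd_swing : bnd (swing N S r).
Proof.
apply: bndD; last exact: bnd_qroot.
by apply: bndM; [exact: bnd_r|exact: bnd_qroot].
Qed.

Lemma bnd_swing1 v : bnd (fun q z => swing1 N S r q z v).
Proof.
have [bN bS] := bnd_qrootV_of_pos.
apply: bndD; last exact: bnd_qroot1.
by apply: bndM; [exact: bnd_r|exact: bnd_qroot1].
Qed.

Lemma bnd_swing2 u v : bnd (fun q z => swing2 N S r q z u v).
Proof.
have [bN bS] := bnd_qrootV_of_pos.
apply: bndD; last exact: bnd_qroot2.
by apply: bndM; [exact: bnd_r|exact: bnd_qroot2].
Qed.

Lemma bnd_1mid : bnd (fun q _ => 1 - q).
Proof. by apply: bndD; [exact: bnd_cst|exact: bndN bnd_id]. Qed.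

Lemma bnd_obj : bnd f.
Proof.
have bs := bnd_swing; have bq := bnd_id.
apply: bndD; first by apply: bndM; [exact: bnd_1mid|exact: bnd_qval].
apply: bndM => //; apply: bndD; last exact: bnd_cst.
apply: bndD; first by apply: bndM.
apply: bndN; apply: bndM; [exact: bnd_cst|exact: bnd_linear].
Qed.

Lemma bnd_obj1_q v : bnd (fun q z => f1_q q z v).
Proof.
have bs := bnd_swing; have bs1 := bnd_swing1 v; have bq := bnd_id.
have [bN bS] := bnd_qrootV_of_pos; have bc := bnd_cst.
have bn := bnd_qroot N.
apply: bndD.
  apply: bndD; first by apply: bndN; apply: bndM => //; exact: bnd_qpol.
  by apply: bndD => //; apply: bndM => //; exact: bndM.
apply: bndM => //; apply: bndM.
  by apply: bndM => //; exact: bnd_param r1_der.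
by apply: bndD; apply: bndM => //; exact: bnd_qroot1.
Qed.

Lemma bnd_obj2 u v : bnd (fun q z => f2 q z u v).
Proof.
have bs := bnd_swing; have bs1 := bnd_swing1; have bs2 := bnd_swing2 u v.
have bc := bnd_cst.
apply: bndD; first by apply: bndM => //; exact: bnd_1mid.
apply: bndM; first exact: bnd_id.
by apply: bndM => //; apply: bndD; exact: bndM.
Qed.

(** The bound [t <= t ^ 2 + 1] turns absolute values of entries into elements of
    the ring of bounded functions. *)
Lemma hessian_bounded : exists C, forall q z, lo <= q <= hi -> D z ->
  opnorm2 (hessian (f q) z) <= C.
Proof.
have [C HC] : bnd (fun q z => \sum_i \sum_j
    (f2 q z (e_ i) (e_ j) ^+ 2 + 1)).
  apply: bnd_sum => i; apply: bnd_sum => j; apply: bndD; last exact: bnd_cst.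
  by apply: bndM; exact: bnd_obj2.
exists C => q z qB Dz; apply: le_trans (opnorm2_le _) _.
apply: le_trans (le_trans (ler_norm _) (HC q z qB Dz)).
apply: ler_sum => i _; apply: ler_sum => j _; rewrite hessianE//.
rewrite -[X in _ <= X + _]real_normK ?num_real//.
have := sqr_ge0 (`|f2 q z (e_ i) (e_ j)| - 1).
by have := normr_ge0 (f2 q z (e_ i) (e_ j)); nra.
Qed.

Lemma mixed_bounded : exists C, forall q z, lo <= q <= hi -> D z ->
  enorm (mixed q z) <= C.
Proof.
have [C HC] : bnd (fun q z => \sum_i (f1_q q z (e_ i) ^+ 2 + 1)).
  apply: bnd_sum => i; apply: bndD; last exact: bnd_cst.
  by apply: bndM; exact: bnd_obj1_q.
exists C => q z qB Dz; apply: le_trans (enorm_le_sum _) _.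
apply: le_trans (le_trans (ler_norm _) (HC q z qB Dz)).
apply: ler_sum => i _; rewrite mixedE//.
rewrite -[X in _ <= X + _]real_normK ?num_real//.
have := sqr_ge0 (`|f1_q q z (e_ i)| - 1).
by have := normr_ge0 (f1_q q z (e_ i)); nra.
Qed.

End RowObjective.

(** * Rate of projected gradient steps *)

Section Rate.
Context {R : realType} {m : nat}.
Implicit Types (z g : 'rV[R]_m).

(** The three-point inequality of a projected gradient step of length [1 / L]:
    the descent inequality at the new point and the tangent lower bound at the
    comparison point [w] are combined through the variational inequality of
    the projection. *)
Lemma projected_step_gap (L sigma h Jz' Jw : R) z g z' w : 0 < L ->
  Jz' <= h + dot g (z' - z) + L / 2 * dot (z' - z) (z' - z) ->
  h + dot g (w - z) + sigma * dot (w - z) (w - z) <= Jw ->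
  dot (z - L^-1 *: g - z') (w - z') <= 0 ->
  Jz' - Jw <= L / 2 * (dot (z - w) (z - w) - dot (z' - w) (z' - w))
              - sigma * dot (z - w) (z - w).
Proof.
move=> L0; rewrite !dot_bilin (dotC z' z) (dotC w z) (dotC z' w).
move=> up low proj.
have {}proj : dot z w - dot z z' - L^-1 * (dot g w - dot g z') - dot w z' + dot z' z' <= 0.
  by apply: le_trans proj; rewrite (dotC w z'); lra.
have : L * (dot z w - dot z z' - dot w z' + dot z' z') <= dot g w - dot g z'.
  have := ler_wpM2l (ltW L0) proj; rewrite mulr0.
  have -> : L * (dot z w - dot z z' - L^-1 * (dot g w - dot g z') - dot w z' + dot z' z')
     = L * (dot z w - dot z z' - dot w z' + dot z' z') - (dot g w - dot g z').
    by field; rewrite gt_eqF.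
  by lra.
lra.
Qed.

(** Nonnegative gaps make [dist2] contract by the factor [1 - 2 sigma / L], at
    most [1 - sigma / L <= exp (- sigma / L)], an estimate valid for all
    [sigma / L >= 0].  The gap itself is read off the last step, hence [0 < T]. *)
Lemma linear_rate (L sigma : R) (gap dist2 : nat -> R) T :
  0 < L -> 0 <= sigma -> (forall k, 0 <= dist2 k) ->
  (forall k, (k < T)%N -> 0 <= gap k.+1) ->
  (forall k, (k < T)%N ->
    gap k.+1 <= L / 2 * (dist2 k - dist2 k.+1) - sigma * dist2 k) ->
  (0 < T)%N -> gap T <= L / 2 * expR (- (sigma / L * T%:R)) * dist2 0%N.
Proof.
move=> L0 s0 d0 g0 step T0.
have contr k : (k < T)%N -> gap k.+1 + L / 2 * dist2 k.+1 <=
    L / 2 * (expR (- (sigma / L)) * dist2 k).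
  move=> kT; have := step k kT; have := d0 k.
  have := expR_ge1Dx (- (sigma / L)); set E := expR _ => E1 dk.
  have : (1 - sigma / L) * dist2 k <= E * dist2 k by rewrite ler_wpM2r.
  move=> /(ler_wpM2l (_ : 0 <= L / 2)) => /(_ (divr_ge0 (ltW L0) (ler0n _ _))).
  have -> : L / 2 * ((1 - sigma / L) * dist2 k) =
      L / 2 * dist2 k - sigma * dist2 k / 2 by field; rewrite gt_eqF.
  have := mulr_ge0 s0 dk; lra.
have dec k : (k <= T)%N -> dist2 k <= expR (- (sigma / L * k%:R)) * dist2 0%N.
  elim: k => [|k IH] kT; first by rewrite mulr0 oppr0 expR0 mul1r.
  have L2 : 0 < L / 2 by rewrite divr_gt0.
  rewrite -(ler_pM2l L2).
  have := contr k kT; have := g0 k kT => gk ck.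
  apply: (@le_trans _ _ (L / 2 * (expR (- (sigma / L)) * dist2 k))); first lra.
  rewrite ler_wpM2l ?(ltW L2)// -natr1 mulrDr mulr1 opprD addrC expRD -mulrA.
  by rewrite ler_wpM2l ?expR_ge0// IH// ltnW.
case: T T0 {step} g0 contr dec => // T _ g0 contr dec.
have := contr T (ltnSn T); have := dec T (leqnSn T).
rewrite -(natr1 T) mulrDr mulr1 opprD [_ + - (sigma / L)]addrC expRD.
move=> /(ler_wpM2l (expR_ge0 (- (sigma / L)))).
move=> /(ler_wpM2l (_ : 0 <= L / 2)) => /(_ (divr_ge0 (ltW L0) (ler0n _ _))).
have := mulr_ge0 (divr_ge0 (ltW L0) (ler0n R 2)) (d0 T.+1).
rewrite !mulrA; lra.
Qed.

End Rate.

(** * The portfolio model *)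

Section Instance.
Context {R : realType} {d : nat}.
Variables (PN PS0 : probability (borel R d) R) (r : R -> R) (gamma : R).
Hypothesis PN_moment2 : finite_second_moment PN.
Hypothesis PN_cov : posdefmx (covmx PN).
Hypothesis PS0_cov : posdefmx (covmx PS0).
Hypothesis d_gt0 : (0 < d)%N.

Local Notation V := 'rV[R]_(d + 1).
Implicit Types (z u v w : V) (t : R).

Definition wpart z : 'rV[R]_d := lsubmx z.
Definition apart z : R := rsubmx z 0 0.

Lemma wpart_lin t u v : wpart (t *: u + v) = t *: wpart u + wpart v.
Proof. by rewrite /wpart linearP. Qed.

Lemma apart_lin t u v : apart (t *: u + v) = t * apart u + apart v.
Proof. by rewrite /apart linearP !mxE. Qed.

Lemma wpart_line z t v : wpart (z + t *: v) = wpart z + t *: wpart v.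
Proof. by rewrite addrC wpart_lin addrC. Qed.

Lemma apart_line z t v : apart (z + t *: v) = apart z + t * apart v.
Proof. by rewrite addrC apart_lin addrC. Qed.

Lemma wpartB u v : wpart (u - v) = wpart u - wpart v.
Proof. by rewrite /wpart linearB. Qed.

Lemma apartB u v : apart (u - v) = apart u - apart v.
Proof. by rewrite /apart linearB !mxE. Qed.

Lemma pairv_parts z : pairv (wpart z) (apart z) = z.
Proof. by rewrite /pairv /apart -mx11_scalar hsubmxK. Qed.

Lemma wpart_pairv (x : 'rV[R]_d) a : wpart (pairv x a) = x.
Proof. by rewrite /wpart /pairv row_mxKl. Qed.

Lemma apart_pairv (x : 'rV[R]_d) a : apart (pairv x a) = a.
Proof. by rewrite /apart /pairv row_mxKr mxE eqxx. Qed.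

Lemma dot_pairv (x y : 'rV[R]_d) a b :
  dot (pairv x a) (pairv y b) = dot x y + a * b.
Proof.
rewrite /pairv /dot tr_row_mx mul_row_col mxE tr_scalar_mx -scalar_mxM.
by rewrite [in RHS]/GRing.add/= [a * b]lock !mxE -lock eqxx.
Qed.

Lemma dot_parts z w : dot z w = dot (wpart z) (wpart w) + apart z * apart w.
Proof. by rewrite -[z in LHS]pairv_parts -[w in LHS]pairv_parts dot_pairv. Qed.

Definition sqnormx : quadratic V.
Proof.
refine (@Quadratic R _ (fun z => dot (wpart z) (wpart z))
  (fun z v => dot (wpart z) (wpart v)) (fun u v => dot (wpart u) (wpart v)) _ _ _).
- move=> z v t; rewrite wpart_line !dot_bilin (dotC (wpart v) (wpart z)); ring.
- by move=> z u v t; rewrite wpart_line !dot_bilin.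
- by move=> z t u v; rewrite wpart_lin !dot_bilin.
Defined.

Definition cdev z : R := dot (wpart z) (meanv PS0) - apart z.

Lemma cdev_lin t u v : cdev (t *: u + v) = t * cdev u + cdev v.
Proof. by rewrite /cdev wpart_lin apart_lin !dot_bilin; ring. Qed.

Lemma cdev_line z t v : cdev (z + t *: v) = cdev z + t * cdev v.
Proof. by rewrite addrC cdev_lin addrC. Qed.

(** [Sgamma ^ 2] as a quadratic function of the pair: the inner offset
    [(2 a + gamma) / 2] is split into the linear part [a] and a constant. *)
Definition sqS : quadratic V.
Proof.
refine (@Quadratic R _
  (fun z => dot (wpart z *m covmx PS0) (wpart z) + (cdev z - gamma / 2) ^+ 2)
  (fun z v => dot (wpart z *m covmx PS0) (wpart v) + (cdev z - gamma / 2) * cdev v)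
  (fun u v => dot (wpart u *m covmx PS0) (wpart v) + cdev u * cdev v) _ _ _).
- move=> z v t; rewrite wpart_line cdev_line mulmxDl -scalemxAl !dot_bilin.
  rewrite (dot_mulmx_sym (wpart v) (wpart z)); last by case: PS0_cov.
  by ring.
- by move=> z u v t; rewrite wpart_line cdev_line mulmxDl -scalemxAl !dot_bilin; ring.
- by move=> z t u v; rewrite wpart_lin cdev_lin !dot_bilin; ring.
Defined.

Lemma Mmx_sym : (Mmx PN)^T = Mmx PN.
Proof.
have [sS _] := PN_cov.
by rewrite /Mmx tr_block_mx !linearN/= trmxK trmx1 linearD/= sS trmx_mul trmxK.
Qed.

Lemma mulmx_Mmx z : z *m Mmx PN =
  pairv (wpart z *m (covmx PN + (meanv PN)^T *m meanv PN) - apart z *: meanv PN)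
        (apart z - dot (wpart z) (meanv PN)).
Proof.
rewrite -[z in LHS]pairv_parts /pairv /Mmx mul_row_block; congr row_mx.
  by rewrite mulmxN mul_scalar_mx.
apply/matrixP => i j; rewrite !ord1 mulmx1 mulmxN /dot !mxE eqxx !mulr1n.
by rewrite addrC.
Qed.

Lemma dot_Mmx z : dot (z *m Mmx PN) z =
  dot (wpart z *m (covmx PN + (meanv PN)^T *m meanv PN)) (wpart z)
  - 2 * apart z * dot (wpart z) (meanv PN) + apart z ^+ 2.
Proof.
rewrite mulmx_Mmx dot_parts wpart_pairv apart_pairv !dot_bilin.
by rewrite (dotC (meanv PN)); ring.
Qed.

(** The form equals [x Sigma x' + (x mu' - a) ^ 2]: where [x] vanishes, the
    second square reduces to [a ^ 2]. *)
Lemma dot_Mmx_gt0 z : z != 0 -> 0 < dot (z *m Mmx PN) z.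
Proof.
rewrite dot_Mmx mulmxDr dot_bilin => z0.
have -> : dot (wpart z *m ((meanv PN)^T *m meanv PN)) (wpart z) =
    dot (wpart z) (meanv PN) ^+ 2.
  rewrite mulmxA {1}[wpart z *m _]mx11_scalar mul_scalar_mx dotZl.
  by rewrite (dotC (meanv PN)) expr2.
have [x0|x0] := eqVneq (wpart z) 0.
  have a0 : apart z != 0.
    apply: contra z0 => /eqP a0; rewrite -(pairv_parts z) x0 a0.
    by rewrite -dot_eq0 dot_pairv dot0l mul0r addr0.
  rewrite x0 mul0mx !dot0l mulr0 expr0n addr0 subr0 add0r.
  by rewrite lt0r sqr_ge0 sqrf_eq0 a0.
have [_ pS] := PN_cov; have := pS _ x0.
have := sqr_ge0 (dot (wpart z) (meanv PN) - apart z); lra.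
Qed.

Lemma dot_Mmx_ge0 z : 0 <= dot (z *m Mmx PN) z.
Proof.
have [->|z0] := eqVneq z 0; first by rewrite mul0mx dot0l.
exact/ltW/dot_Mmx_gt0.
Qed.

(** The expected loss under the nominal law; its second-order part is the form
    of [M], hence the curvature [(1 - q) M] kept by [obj_tangent_le]. *)
Definition nominal : quadratic V.
Proof.
refine (@Quadratic R _
  (fun z => dot (z *m Mmx PN) z - gamma * dot (wpart z) (meanv PN))
  (fun z v => dot (z *m Mmx PN) v - gamma / 2 * dot (wpart v) (meanv PN))
  (fun u v => dot (u *m Mmx PN) v) _ _ _).
- move=> z v t; rewrite wpart_line mulmxDl -scalemxAl !dot_bilin.
  by rewrite (dot_mulmx_sym v z Mmx_sym); field.
- by move=> z u v t; rewrite mulmxDl -scalemxAl !dot_bilin; ring.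
- by move=> z t u v; rewrite wpart_lin !dot_bilin; ring.
Defined.

Lemma hpairE : hpair PN PS0 r gamma =
  obj nominal sqnormx sqS apart gamma (gamma ^+ 2 / 4) r.
Proof.
apply/funext => q; apply/funext => z.
rewrite /hpair /hobj expectation_psi// /obj /swing /qroot/= dot_Mmx.
rewrite -/(wpart z) -/(apart z) /Sgamma /enorm /cdev.
have -> : dot (wpart z) (meanv PS0) - (2 * apart z + gamma) / 2 =
    dot (wpart z) (meanv PS0) - apart z - gamma / 2 by field.
by ring.
Qed.

Lemma sqnorm_like_sqnormx : sqnorm_like sqnormx.
Proof.
move=> z v /=; rewrite -[wpart (z + v)]/(lsubmx (z + v)) linearD/= -/(wpart z) -/(wpart v).
by rewrite -dotDr; exact: dot_le_enorm.
Qed.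

Lemma cov_ge0 (x : 'rV[R]_d) : 0 <= dot (x *m covmx PS0) x.
Proof.
have [->|x0] := eqVneq x 0; first by rewrite mul0mx dot0l.
by have [_ pS] := PS0_cov; exact/ltW/pS.
Qed.

Lemma sqnorm_like_sqS : sqnorm_like sqS.
Proof.
move=> z v /=.
have -> : wpart (z + v) = wpart z + wpart v by rewrite /wpart linearD.
have -> : cdev (z + v) = cdev z + cdev v.
  by have := cdev_line z 1 v; rewrite scale1r mul1r.
rewrite -addrA.
set x := wpart z; set y := wpart v; set a := cdev z; set b := cdev v.
have -> : dot (x *m covmx PS0) x + ((a - gamma / 2) ^+ 2 +
    (dot (x *m covmx PS0) y + (a - gamma / 2) * b)) =
    dot (x *m covmx PS0) (x + y) + (a - gamma / 2) * (a + b - gamma / 2).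
  by rewrite dotDr; ring.
apply: discriminant_le; rewrite ?addr_ge0 ?cov_ge0 ?sqr_ge0// => t.
have := cov_ge0 (x + t *: (x + y)).
have := sqr_ge0 ((a - gamma / 2) + t * (a + b - gamma / 2)).
rewrite mulmxDl -scalemxAl !(dotDl _ (t *: _)) !(dotDr _ (t *: _)).
rewrite !(dotZl, dotZr) (dot_mulmx_sym (x + y) x); last by case: PS0_cov.
lra.
Qed.

Variables l u : R.

Definition domain : set V := [set z | simplex (wpart z) /\ l <= apart z <= u].

Lemma simplex_convex (x y : 'rV[R]_d) t : simplex x -> simplex y ->
  0 <= t <= 1 -> simplex (x + t *: (y - x)).
Proof.
move=> [x0 x1] [y0 y1] /andP[t0 t1]; split=> [i|].
  by rewrite !mxE; have := x0 i; have := y0 i; nra.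
under eq_bigr do rewrite !mxE.
by rewrite big_split/= -mulr_sumr big_split/= x1 y1 sumrN x1 subrr mulr0 addr0.
Qed.

Lemma domain_convex z w t : domain z -> domain w -> 0 <= t <= 1 ->
  domain (z + t *: (w - z)).
Proof.
move=> [sz az] [sw aw] t01; split.
  rewrite wpart_line wpartB.
  exact: simplex_convex.
rewrite apart_line apartB.
by move: az aw t01 => /andP[? ?] /andP[? ?] /andP[? ?]; apply/andP; split; nra.
Qed.

(** Cauchy-Schwarz against the all-ones vector. *)
Lemma simplex_norm_ge (x : 'rV[R]_d) : simplex x -> d%:R^-1 <= dot x x.
Proof.
move=> [x0 x1]; have d0 : 0 < d%:R :> R by rewrite ltr0n.
have := dot_le_enorm x (const_mx 1).
have -> : dot x (const_mx 1) = 1.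
  by rewrite dot_sum -[RHS]x1; apply: eq_bigr => i _; rewrite mxE mulr1.
move=> h; have : 1 <= (enorm x * enorm (const_mx 1 : 'rV[R]_d)) ^+ 2.
  by rewrite exprn_ege1.
rewrite exprMn !sqr_enorm.
have -> : dot (const_mx 1 : 'rV[R]_d) (const_mx 1) = d%:R.
  rewrite dot_sum; under eq_bigr do rewrite !mxE mulr1.
  by rewrite sumr_const card_ord.
by rewrite -ler_pdivrMr// mul1r.
Qed.

Lemma domain_pos : exists2 c, 0 < c &
  forall z, domain z -> c <= sqnormx z /\ c <= sqS z.
Proof.
have [c c0 cS] := posdefmx_coercive d_gt0 PS0_cov.
have d0 : 0 < d%:R :> R by rewrite ltr0n.
exists (Num.min 1 c / d%:R); first by rewrite divr_gt0// lt_min ltr01.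
move=> z [sz _]; have N0 := simplex_norm_ge sz.
have c1 : Num.min 1 c <= 1 by rewrite ge_min lexx.
have cc : Num.min 1 c <= c by rewrite ge_min lexx orbT.
have di : 0 <= d%:R^-1 :> R by rewrite invr_ge0 ltW.
split=> /=; first by apply: le_trans N0; rewrite ler_piMl.
apply: (@le_trans _ _ (c * dot (wpart z) (wpart z))).
  by apply: ler_pM => //; rewrite le_min ler01 ltW.
by apply: le_trans (cS _) _; rewrite lerDl sqr_ge0.
Qed.

Lemma domain_bounded lo hi (i : 'I_(d + 1)) :
  bnd lo hi domain (fun _ z => z 0 i).
Proof.
exists (1 + `|l| + `|u|) => _ z _ [[z0 z1] az].
have l0 := normr_ge0 l; have u0 := normr_ge0 u.
rewrite -(pairv_parts z) /pairv mxE; case: split_ordP => j _.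
  have -> : wpart z 0 j = `|wpart z 0 j| by rewrite ger0_norm.
  rewrite normr_id ger0_norm//.
  have : wpart z 0 j <= 1.
    by rewrite -z1 (bigD1 j)//= lerDl sumr_ge0.
  by lra.
rewrite (ord1 j) mxE eqxx mulr1n ler_norml.
have := ler_norm u; have := lerNnormlW (lexx `|l|); lra.
Qed.

End Instance.

(** * Choice of the parameter interval *)

Section Radius.
Context {R : realType}.
Variables (r f1 f2 : R -> R) (q0 : R).
Hypothesis q0_01 : 0 < q0 < 1.
Hypothesis r_ge0 : forall q : R, 0 <= q <= 1 -> 0 <= r q.
Hypothesis r_der : forall q : R, 0 < q < 1 -> is_derive q 1 r (f1 q).
Hypothesis f1_der : forall q : R, 0 < q < 1 -> is_derive q 1 f1 (f2 q).
Hypothesis f2_cont : {for q0, continuous f2}.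
Hypothesis f1_0 : f1 q0 = 0.
Hypothesis f2_lt0 : f2 q0 < 0.

Lemma near_interval (P : R -> Prop) : (\forall q \near q0, P q) ->
  exists2 e, 0 < e < Num.min q0 (1 - q0) &
    forall q, q0 - e <= q <= q0 + e -> P q.
Proof.
move=> /nbhs_ballP[e /= e0 He].
have m0 : 0 < Num.min q0 (1 - q0) by move: q0_01; rewrite lt_min; lra.
exists (Num.min e (Num.min q0 (1 - q0)) / 2).
  have : Num.min e (Num.min q0 (1 - q0)) <= Num.min q0 (1 - q0).
    by rewrite ge_min lexx orbT.
  have : 0 < Num.min e (Num.min q0 (1 - q0)) by rewrite lt_min e0.
  lra.
move=> q qB; apply: He; rewrite /ball/= ltr_norml.
have : Num.min e (Num.min q0 (1 - q0)) <= e by rewrite ge_min lexx.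
lra.
Qed.

Lemma interval_01 e q : 0 < e < Num.min q0 (1 - q0) ->
  q0 - e <= q <= q0 + e -> 0 < q < 1.
Proof. by rewrite lt_min; lra. Qed.

(** Since [r' (q0) = 0 > r'' (q0)], [q0] is a strict local maximum, and the
    values of [r] nearby are nonnegative. *)
Lemma radius_gt0 : 0 < r q0.
Proof.
have [|e eB He] := @near_interval (fun q => f2 q <= f2 q0 / 2).
  by have h : f2 q0 < f2 q0 / 2; [have := f2_lt0; lra|exact: (cvgr_le _ f2_cont _ h)].
have e0 : 0 < e by case/andP: eB.
pose p := q0 + e; have pe : p - q0 = e by rewrite /p addrAC subrr add0r.
have seg (t : R) : 0 <= t <= 1 -> q0 - e <= q0 + t * (p - q0) <= q0 + e.
  move=> /andP[t0 t1]; rewrite pe.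
  have := ler_wpM2r (ltW e0) t1; have := mulr_ge0 t0 (ltW e0); lra.
have d1 (t : R) : 0 <= t <= 1 ->
    is_derive t 1 (fun s => r (q0 + s * (p - q0))) ((p - q0) * f1 (q0 + t * (p - q0))).
  by move=> t01; apply: is_derive_segment; apply: r_der; exact/(interval_01 eB)/seg.
have d2 (t : R) : 0 <= t <= 1 ->
    is_derive t 1 (fun s => (p - q0) * f1 (q0 + s * (p - q0)))
      ((p - q0) * ((p - q0) * f2 (q0 + t * (p - q0)))).
  move=> t01; apply: is_deriveZ; apply: is_derive_segment; apply: f1_der.
  exact/(interval_01 eB)/seg.
have b2 (t : R) : 0 <= t <= 1 ->
    (p - q0) * ((p - q0) * f2 (q0 + t * (p - q0))) <= e ^+ 2 * (f2 q0 / 2).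
  by move=> /seg/He; rewrite pe => h; have := sqr_ge0 e; nra.
have := taylor2_le d1 d2 b2; rewrite mul1r mul0r addr0 subrKC f1_0 mulr0 addr0.
have : 0 <= r p.
  apply: r_ge0; have := interval_01 eB (q := p); rewrite /p.
  by move=> H; have := H _; lra.
have : 0 < e ^+ 2 by rewrite exprn_gt0.
have := f2_lt0; nra.
Qed.

(** At [q0] the left-hand side of the second inequality is [2 q0 r r''], twice
    the negative right-hand side; this slack survives on a neighbourhood by
    continuity and is why [K4] is half the curvature available at [q0]. *)
Lemma concavity_interval : exists2 e, 0 < e < Num.min q0 (1 - q0) &
  forall q, q0 - e <= q <= q0 + e ->
  2 * f1 q + q * f2 q <= 0 /\
  2 * r q * (2 * f1 q + q * f2 q) + 2 * q * f1 q ^+ 2 <= q0 * r q0 * f2 q0.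
Proof.
have cr : r q @[q --> q0] --> r q0.
  have /derivable1_diffP/differentiable_continuous :=
    @ex_derive _ _ _ _ _ _ _ (r_der q0_01); exact.
have c1 : f1 q @[q --> q0] --> f1 q0.
  have /derivable1_diffP/differentiable_continuous :=
    @ex_derive _ _ _ _ _ _ _ (f1_der q0_01); exact.
have cid : q @[q --> q0] --> q0 by exact: cvg_id.
have cg : 2 * f1 q + q * f2 q @[q --> q0] --> 2 * f1 q0 + q0 * f2 q0.
  by apply: cvgD; apply: cvgM => //; exact: cvg_cst.
have ch : 2 * r q * (2 * f1 q + q * f2 q) + 2 * q * (f1 q * f1 q) @[q --> q0] -->
    2 * r q0 * (2 * f1 q0 + q0 * f2 q0) + 2 * q0 * (f1 q0 * f1 q0).
  apply: cvgD; apply: cvgM => //; first by apply: cvgM => //; exact: cvg_cst.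
    by apply: cvgM => //; exact: cvg_cst.
  exact: cvgM.
have r0 := radius_gt0; have [q00 _] := andP q0_01.
have neg : q0 * f2 q0 < 0 by rewrite pmulr_rlt0.
apply: near_interval; apply: filterS2.
- move=> q; exact: conj.
- by apply: (cvgr_le _ cg); rewrite f1_0 mulr0 add0r.
- apply: (cvgr_le _ ch); rewrite f1_0 !mulr0 add0r addr0; nra.
Qed.

End Radius.

(** * The constants and the worst-case value *)

Section Constants.
Context {R : realType} {d : nat}.
Variables (PN PS0 : probability (borel R d) R) (r f1 f2 : R -> R).
Variables (gamma q0 eps l u : R).
Hypothesis PN_moment2 : finite_second_moment PN.
Hypothesis PN_cov : posdefmx (covmx PN).
Hypothesis PS0_cov : posdefmx (covmx PS0).
Hypothesis d_gt0 : (0 < d)%N.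
Hypothesis r_der : forall q : R, q0 - eps <= q <= q0 + eps -> is_derive q 1 r (f1 q).
Hypothesis f1_der : forall q : R, q0 - eps <= q <= q0 + eps -> is_derive q 1 f1 (f2 q).

Local Notation A := (nominal gamma PN_cov).
Local Notation S := (sqS gamma PS0_cov).
Local Notation N := (sqnormx).
Local Notation f := (obj A N S apart gamma (gamma ^+ 2 / 4) r).
Local Notation D := (@domain R d l u).
Local Notation I := `[l, u]%classic.
Local Notation la_lin := (@apart_lin R d).
Local Notation pos := (domain_pos gamma PS0_cov d_gt0 l u).
Local Notation bounded := (@domain_bounded R d l u (q0 - eps) (q0 + eps)).

Lemma domain_pairv (x : 'rV[R]_d) a : D (pairv x a) <-> simplex x /\ I a.
Proof.
by rewrite /domain/= wpart_pairv apart_pairv in_itv/=.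
Qed.

Lemma hobj_pairv q x a : hobj PN PS0 r gamma q x a = f q (pairv x a).
Proof.
rewrite -(hpairE r gamma PN_moment2 PN_cov PS0_cov) /hpair.
by rewrite -/(wpart _) -/(apart _) wpart_pairv apart_pairv.
Qed.

(** A supremum bounds its set only if that set is bounded above, which is what
    [hessian_bounded] provides. *)
Lemma le_K2const q z : q0 - eps <= q <= q0 + eps -> D z ->
  opnorm2 (hessian (f q) z) <= K2const PN PS0 r gamma q0 eps I.
Proof.
move=> qB Dz; rewrite /K2const (hpairE r gamma PN_moment2 PN_cov PS0_cov).
have [C HC] := hessian_bounded A gamma (gamma ^+ 2 / 4) la_lin r_der pos bounded.
apply: ub_le_sup.
  exists C => _ [p [x [a [pB sx Ia ->]]]]; apply: HC => //.
  by apply/domain_pairv.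
exists q, (wpart z), (apart z); split; first exact: qB.
- by case: Dz.
- by rewrite /= in_itv; case: Dz.
- by rewrite pairv_parts.
Qed.

Lemma le_K3const q z : q0 - eps <= q <= q0 + eps -> D z ->
  enorm (mixed A N S apart gamma (gamma ^+ 2 / 4) r q z) <=
  K3const PN PS0 r gamma q0 eps I.
Proof.
move=> qB Dz; rewrite /K3const /mixed_partial.
rewrite (hpairE r gamma PN_moment2 PN_cov PS0_cov).
have [C HC] := mixed_bounded A gamma (gamma ^+ 2 / 4) la_lin r_der f1_der pos bounded.
apply: ub_le_sup.
  exists C => _ [p [x [a [pB sx Ia ->]]]]; apply: HC => //.
  by apply/domain_pairv.
exists q, (wpart z), (apart z); split; first exact: qB.
- by case: Dz.
- by rewrite /= in_itv; case: Dz.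
- by rewrite pairv_parts.
Qed.

Lemma Jobj_le x a C : 0 <= eps -> (forall p, q0 - eps <= p <= q0 + eps -> f p (pairv x a) <= C) ->
  Jobj PN PS0 r gamma q0 eps x a <= C.
Proof.
move=> eps0 HC; apply: ge_sup.
  by exists (hobj PN PS0 r gamma q0 x a), q0 => //=; rewrite in_itv/=; lra.
by move=> y [p]; rewrite /= in_itv/= => pB <-; rewrite hobj_pairv; exact: HC.
Qed.

Lemma le_Jobj q x a : q0 - eps <= q <= q0 + eps -> D (pairv x a) ->
  f q (pairv x a) <= Jobj PN PS0 r gamma q0 eps x a.
Proof.
move=> qB Dz.
have [C HC] := bnd_obj A N S gamma (gamma ^+ 2 / 4) la_lin r_der bounded.
apply: ub_le_sup; last by exists q; [rewrite /= in_itv|exact: hobj_pairv].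
exists C => y [p]; rewrite /= in_itv/= => pB <-; rewrite hobj_pairv.
exact: le_trans (ler_norm _) (HC p _ pB Dz).
Qed.

End Constants.

(** * Convergence of the algorithm *)

Theorem theorem3 (R : realType) (d : nat) (gamma : R)
    (PN PS0 : probability (borel R d) R) (r : R -> R) (q0 : R)
    (d_gt0 : (0 < d)%N) (gamma_gt0 : 0 < gamma)
    (PN_moment2 : finite_second_moment PN)
    (PS0_moment2 : finite_second_moment PS0)
    (PN_cov : posdefmx (covmx PN)) (PS0_cov : posdefmx (covmx PS0))
    (r_ge0 : forall q, 0 <= q <= 1 -> 0 <= r q)
    (r_C2 : C2_on `[0, 1] r)
    (q0_01 : 0 < q0 < 1)
    (dr_q0 : r^`() q0 = 0) (d2r_q0 : r^`(2) q0 < 0) :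
  let K4 := - q0 * r q0 * r^`(2)%classic q0 / d%:R in
  0 < K4 /\
  exists eps0 : R, 0 < eps0 < Num.min q0 (1 - q0) /\
  forall eps : R, 0 < eps < Num.min q0 (1 - q0) -> eps <= eps0 ->
  forall l u : R,
  (forall x P, simplex x -> ambiguity_set PN PS0 r q0 eps P ->
    (l%:E <= 'E_P[fun z : 'rV[R]_d => dot x z] <= u%:E)%E) ->
  let I := `[l, u]%classic in
  let J := Jobj PN PS0 r gamma q0 eps in
  let K2 := K2const PN PS0 r gamma q0 eps I in
  let K3 := K3const PN PS0 r gamma q0 eps I in
  forall (T : nat) (xs : nat -> 'rV[R]_d) (as_ qs : nat -> R),
  (0 < T)%N ->
  psubgrad_run PN PS0 r gamma q0 eps I
    (fun=> K4 / (K3 ^+ 2 + K2 * K4)) T xs as_ qs ->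
  forall (xstar : 'rV[R]_d) (astar : R),
  is_minimizer_J PN PS0 r gamma q0 eps I xstar astar ->
  J (xs T) (as_ T) - J xstar astar <=
    (K3 ^+ 2 + K2 * K4) / (2 * K4) *
    expR (- (K4 * lambdaM PN * (1 - q0 - eps0) / (K3 ^+ 2 + K2 * K4) * T%:R)) *
    enorm (pairv (xs 0%N) (as_ 0%N) - pairv xstar astar) ^+ 2.
Proof.
have [f1 [f2 Hr]] := C2_on_interior r_C2.
have d1 (q : R) : 0 < q < 1 -> is_derive q 1 r (f1 q) by move=> /Hr[].
have d2 (q : R) : 0 < q < 1 -> is_derive q 1 f1 (f2 q) by move=> /Hr[].
have c2 : {for q0, continuous f2} by have [] := Hr q0 q0_01.
have [r1E r2E] := derive1n2_interior d1 d2 q0_01.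
rewrite r1E in dr_q0; rewrite r2E in d2r_q0 *.
have r0 := radius_gt0 q0_01 r_ge0 d1 d2 c2 dr_q0 d2r_q0.
have [eps0 eps0B conc] := concavity_interval q0_01 r_ge0 d1 d2 c2 dr_q0 d2r_q0.
have [q00 q01] := andP q0_01.
have dR : 0 < d%:R :> R by rewrite ltr0n.
move=> K4.
have K4_gt0 : 0 < K4.
  by rewrite /K4 divr_gt0// mulNr mulNr -mulrA -mulrN -mulrN !mulr_gt0// oppr_gt0.
split=> //; exists eps0; split=> // eps epsB le_eps l u _ I J K2 K3 T xs as_ qs T0.
move=> [sx0 run] xstar astar [sxs Ias Jmin].
have eps_gt0 : 0 < eps by case/andP: epsB.
have q01B q : q0 - eps <= q <= q0 + eps -> 0 < q < 1 := interval_01 epsB.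
have wide q : q0 - eps <= q <= q0 + eps -> q0 - eps0 <= q <= q0 + eps0 by lra.
have r_der q : q0 - eps <= q <= q0 + eps -> is_derive q 1 r (f1 q).
  by move=> /q01B; exact: d1.
have f1_der q : q0 - eps <= q <= q0 + eps -> is_derive q 1 f1 (f2 q).
  by move=> /q01B; exact: d2.
pose A := nominal gamma PN_cov; pose S := sqS gamma PS0_cov.
pose N : quadratic 'rV[R]_(d + 1) := sqnormx.
pose f := obj A N S apart gamma (gamma ^+ 2 / 4) r.
pose D := domain (R := R) (d := d) l u.
have pos := domain_pos gamma PS0_cov d_gt0 l u.
have hE : hpair PN PS0 r gamma = f := hpairE r gamma PN_moment2 PN_cov PS0_cov.
have hobjE q x a : hobj PN PS0 r gamma q x a = f q (pairv x a).
  exact: hobj_pairv.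
have DE (x : 'rV[R]_d) a : D (pairv x a) <-> simplex x /\ I a.
  exact: domain_pairv.
have hK2 q z : q0 - eps <= q <= q0 + eps -> D z ->
    opnorm2 (hessian (f q) z) <= K2.
  exact: (le_K2const gamma PN_moment2 PN_cov PS0_cov d_gt0 r_der).
have hK3 q z : q0 - eps <= q <= q0 + eps -> D z ->
    enorm (mixed A N S apart gamma (gamma ^+ 2 / 4) r q z) <= K3.
  exact: (le_K3const gamma PN_moment2 PN_cov PS0_cov d_gt0 r_der f1_der).
(* The choice of [eps0] gives [- d K4 |x| ^ 2], and [|x| ^ 2 >= 1 / d]. *)
have hK4 q z : q0 - eps <= q <= q0 + eps -> D z -> obj_qq N S r f1 f2 q z <= - K4.
  move=> qB [sz _]; have [neg le_c] := conc q (wide q qB).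
  have [q_gt0 q_lt1] := andP (q01B q qB).
  have : obj_qq N S r f1 f2 q z <= - (d%:R * K4) * N z.
    apply: obj_qq_le => //; first by apply: r_ge0; rewrite !ltW.
    - exact: ltW.
    - apply: le_trans le_c _; rewrite /K4.
      suff -> : - (d%:R * (- q0 * r q0 * f2 q0 / d%:R)) = q0 * r q0 * f2 q0 by [].
      by field; rewrite gt_eqF.
    - exact: dot_ge0.
  move=> /le_trans; apply; rewrite mulNr lerN2.
  have := simplex_norm_ge d_gt0 sz; rewrite -(ler_pM2l (mulr_gt0 dR K4_gt0)).
  by apply: le_trans; rewrite [d%:R * K4]mulrC -mulrA mulfV ?mulr1 ?gt_eqF.
pose z k := pairv (xs k) (as_ k); pose zs := pairv xstar astar.
pose g k := grad (f (qs k)) (z k).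
have Dzs : D zs by apply/DE.
have Dz k : (k <= T)%N -> D (z k).
  move=> kT; apply/DE; have [Ia _ _ _] := run k kT; split=> //.
  by case: k kT {Ia} => // k kT; have [_ _ [] ] := run k (ltnW kT).
have qsB k : (k <= T)%N -> q0 - eps <= qs k <= q0 + eps.
  by move=> /run[_ [] ].
have qmax k : (k <= T)%N -> forall p, q0 - eps <= p <= q0 + eps ->
    f p (z k) <= f (qs k) (z k).
  by move=> /run[_ [_ H] _ _] p pB; have := H p pB; rewrite !hobjE.
pose sigma := lambdaM PN * (1 - q0 - eps0).
pose L := (K3 ^+ 2 + K2 * K4) / K4.
have up k w : (k <= T)%N -> D w ->
    forall p, q0 - eps <= p <= q0 + eps ->
    f p w <= f (qs k) (z k) + dot (g k) (w - z k) + L / 2 * dot (w - z k) (w - z k).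
  move=> kT Dw p pB; have wE : w = z k + (w - z k) by rewrite addrC subrK.
  rewrite {1}wE; apply: (@descent _ _ A N S apart gamma (gamma ^+ 2 / 4) r f1 f2
    (@apart_lin R d) (q0 - eps) (q0 + eps) D) => //.
  - exact: domain_convex.
  - exact: Dz.
  - by rewrite -wE.
  - exact: qsB.
  - exact: qmax.
have low k w : (k <= T)%N -> D w ->
    f (qs k) (z k) + dot (g k) (w - z k) +
    (1 - qs k) * dot ((w - z k) *m Mmx PN) (w - z k) <= f (qs k) w.
  move=> kT Dw; have [q_gt0 q_lt1] := andP (q01B _ (qsB k kT)).
  rewrite /g /f (dot_grad A gamma (gamma ^+ 2 / 4) r (@apart_lin R d) pos _ _ (Dz k kT)).
  rewrite -[X in _ <= obj _ _ _ _ _ _ _ _ X](subrKC (z k) w).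
  apply: obj_tangent_le => //.
  - exact: apart_lin.
  - exact: sqnorm_like_sqnormx.
  - exact: sqnorm_like_sqS.
  - exact: ltW.
  - by apply: r_ge0; rewrite !ltW.
  - exact: (N_gt0 pos (Dz k kT)).
  - exact: (S_gt0 pos (Dz k kT)).
have JE (x : 'rV[R]_d) a C : (forall p, q0 - eps <= p <= q0 + eps -> f p (pairv x a) <= C) ->
    J x a <= C.
  exact: (Jobj_le PN_moment2 (ltW eps_gt0)).
have Jge q x a : q0 - eps <= q <= q0 + eps -> D (pairv x a) ->
    f q (pairv x a) <= J x a.
  exact: (le_Jobj gamma PN_moment2 PN_cov PS0_cov r_der).
have d1_gt0 : (0 < d + 1)%N by rewrite addn1.
have lam0 : 0 <= lambdaM PN.
  by apply: min_eigenvalue_ge0 => //; [exact: Mmx_sym|exact: dot_Mmx_ge0].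
have s0 : 0 <= 1 - q0 - eps0 by move: eps0B; rewrite lt_min; lra.
have sigma0 : 0 <= sigma by exact: mulr_ge0.
have K2_ge0 : 0 <= K2.
  exact: le_trans (opnorm2_ge0 _) (hK2 _ _ (qsB 0%N isT) (Dz 0%N isT)).
have num_ge0 : 0 <= K3 ^+ 2 + K2 * K4.
  by apply: addr_ge0; [exact: sqr_ge0|exact: mulr_ge0 K2_ge0 (ltW K4_gt0)].
have L_ge0 : 0 <= L by exact: divr_ge0 num_ge0 (ltW K4_gt0).
have lowJ k : (k <= T)%N -> f (qs k) (z k) + dot (g k) (zs - z k) +
    sigma * dot (zs - z k) (zs - z k) <= J xstar astar.
  move=> kT; apply: le_trans (Jge _ _ _ (qsB k kT) Dzs).
  apply: le_trans (low k zs kT Dzs); rewrite lerD2l.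
  have le_q : 1 - q0 - eps0 <= 1 - qs k by have := qsB k kT; lra.
  rewrite /sigma mulrAC mulrC; apply: ler_pM => //.
    by rewrite mulr_ge0 ?dot_ge0.
  exact: min_eigenvalue_le (Mmx_sym PN_cov).
(* If [L = 0], the upper and lower bounds at the last iterate only agree when
   it is the minimizer. *)
have [L0|L_neq0] := eqVneq L 0.
  have zE : zs = z T.
    have := low T zs (leqnn T) Dzs.
    have := up T zs (leqnn T) Dzs (qs T) (qsB T (leqnn T)).
    rewrite L0 mul0r mul0r addr0 => upT lowT.
    have [_ q_lt1] := andP (q01B _ (qsB T (leqnn T))).
    apply/eqP; rewrite -subr_eq0; apply/negPn/negP => /(dot_Mmx_gt0 PN_cov) pos'.
    have : 0 < (1 - qs T) * dot ((zs - z T) *m Mmx PN) (zs - z T).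
      by rewrite mulr_gt0 ?subr_gt0.
    by lra.
  have [-> ->] : xs T = xstar /\ as_ T = astar.
    by rewrite -(wpart_pairv (xs T) (as_ T)) -{2}(apart_pairv (xs T) (as_ T))
      -/(z T) -zE wpart_pairv apart_pairv.
  rewrite subrr; apply: mulr_ge0 (sqr_ge0 _); apply: mulr_ge0 (expR_ge0 _).
  by apply: divr_ge0 num_ge0 _; exact: mulr_ge0 (ler0n _ 2) (ltW K4_gt0).
have L_gt0 : 0 < L by rewrite lt0r L_neq0.
have step k : (k < T)%N -> J (xs k.+1) (as_ k.+1) - J xstar astar <=
    L / 2 * (dot (z k - zs) (z k - zs) - dot (z k.+1 - zs) (z k.+1 - zs))
    - sigma * dot (z k - zs) (z k - zs).
  move=> kT; apply: (projected_step_gap L_gt0 _ (lowJ k (ltnW kT))).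
    by apply: JE => p pB; apply: up => //; [exact: ltnW|exact: Dz].
  have [_ _ xproj astep] := run k (ltnW kT).
  have {xproj astep} [xproj astep] :
      is_eproj (simplex (R := R) (d := d)) (xs k - L^-1 *: wpart (g k)) (xs k.+1) /\
      as_ k.+1 = as_ k - L^-1 * apart (g k).
    by move: xproj astep; rewrite hE /L invf_div.
  (* The coordinate [a] is not projected, so it contributes nothing; the
     coordinate [x] is projected onto the simplex. *)
  rewrite dot_parts.
  have -> : apart (z k - L^-1 *: g k - z k.+1) = 0.
    have apZ : apart (L^-1 *: g k) = L^-1 * apart (g k).
      by rewrite /apart linearZ mxE.
    by rewrite !apartB apZ !apart_pairv astep subrr.
  rewrite mul0r addr0 !wpartB [wpart (_ *: _)]linearZ/= -/(wpart _) !wpart_pairv.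
  exact: proj_variational (@simplex_convex R d) xproj sxs.
have := linear_rate (gap := fun k => J (xs k) (as_ k) - J xstar astar)
  (dist2 := fun k => dot (z k - zs) (z k - zs)) L_gt0 sigma0 _ _ step T0.
rewrite sqr_enorm.
have -> : (K3 ^+ 2 + K2 * K4) / (2 * K4) = L / 2.
  by rewrite /L; field; rewrite gt_eqF.
have -> : K4 * lambdaM PN * (1 - q0 - eps0) / (K3 ^+ 2 + K2 * K4) = sigma / L.
  by rewrite /L invf_div /sigma; ring.
apply=> [k|k kT]; first exact: dot_ge0.
rewrite subr_ge0; apply: Jmin; last by have [] := run k.+1 kT.
by have /DE[] := Dz k.+1 kT.
Qed.
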